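(* Let $T\in\mathcal{BC}^{0,1}(V_5)$ and $s\in\mathbb{R}^6$ with $\|T\|<|s|$. Then all the series below converge and the following expansions hold: $$S^{-1}_{\mathcal{D},L}(s,T)=S^{-1}_{\mathcal{D},R}(s,T)=-4\sum_{m=1}^\infty\sum_{k=1}^mT^{m-k}\overline{T}^{k-1}s^{-1-m}=-4\sum_{m=1}^\infty\sum_{k=1}^ms^{-1-m}T^{m-k}\overline{T}^{k-1};$$ $$S^{-1}_{\Delta,L}(s,T)=-8\sum_{m=2}^\infty\sum_{k=1}^{m-1}(m-k)T^{m-k-1}\overline{T}^{k-1}s^{-1-m},\qquad S^{-1}_{\Delta,R}(s,T)=-8\sum_{m=2}^\infty\sum_{k=1}^{m-1}(m-k)s^{-1-m}T^{m-k-1}\overline{T}^{k-1};$$ $$S^{-1}_{\Delta\mathcal{D},L}(s,T)=S^{-1}_{\Delta\mathcal{D},R}(s,T)=16\sum_{m=3}^\infty\sum_{k=1}^{m-2}(m-k-1)k\,T^{m-k-2}\overline{T}^{k-1}s^{-1-m}=16\sum_{m=3}^\infty\sum_{k=1}^{m-2}(m-k-1)k\,s^{-1-m}T^{m-k-2}\overline{T}^{k-1};$$ $$S^{-1}_{\mathcal{D}^2,L}(s,T)=-8\sum_{m=2}^\infty\sum_{k=1}^{m-1}k\,T^{m-k-1}\overline{T}^{k-1}s^{-1-m},\qquad S^{-1}_{\mathcal{D}^2,R}(s,T)=-8\sum_{m=2}^\infty\sum_{k=1}^{m-1}k\,s^{-1-m}T^{m-k-1}\overline{T}^{k-1};$$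 $$S^{-1}_{\overline{\mathcal{D}},L}(s,T)=2\sum_{m=1}^\infty\Big(mT^{m-1}+2\sum_{k=1}^mT^{m-k}\overline{T}^{k-1}\Big)s^{-1-m},\qquad S^{-1}_{\overline{\mathcal{D}},R}(s,T)=2\sum_{m=1}^\infty s^{-1-m}\Big(mT^{m-1}+2\sum_{k=1}^mT^{m-k}\overline{T}^{k-1}\Big);$$ $$S^{-1}_{\overline{\mathcal{D}}^2,L}(s,T)=4\sum_{m=2}^\infty\Big(m(m-1)T^{m-2}+2\sum_{k=1}^{m-1}(2m-k)T^{m-k-1}\overline{T}^{k-1}\Big)s^{-1-m},$$ $$S^{-1}_{\overline{\mathcal{D}}^2,R}(s,T)=4\sum_{m=2}^\infty s^{-1-m}\Big(m(m-1)T^{m-2}+2\sum_{k=1}^{m-1}(2m-k)T^{m-k-1}\overline{T}^{k-1}\Big);$$ $$S^{-1}_{\Delta\overline{\mathcal{D}},L}(s,T)=-16\sum_{m=3}^\infty\sum_{k=1}^{m-2}(m-k-1)(m+k)T^{m-k-2}\overline{T}^{k-1}s^{-1-m},$$ $$S^{-1}_{\Delta\overline{\mathcal{D}},R}(s,T)=-16\sum_{m=3}^\infty\sum_{k=1}^{m-2}(m-k-1)(m+k)s^{-1-m}T^{m-k-2}\overline{T}^{k-1}.$$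
   Context: $\mathbb{R}_5$ is the real Clifford algebra generated by $e_1,\dots,e_5$ ($e_i^2=-1$, $e_ie_j=-e_je_i$ for $i\neq j$), with basis $e_A$; $\mathbb{R}^6$ is identified with paravectors $s=s_0+\sum_{i=1}^5s_ie_i$, with Euclidean norm $|s|$. $V$ is a real Banach space, $\mathcal{B}(V)$ the bounded $\mathbb{R}$-linear operators on $V$, $V_5=V\otimes\mathbb{R}_5$ with elements $v=\sum_Av_Ae_A$ and norm $\sum_A\|v_A\|$. $\mathcal{B}(V_5)$ is the set of operators $T=\sum_AT_Ae_A$, $T_A\in\mathcal{B}(V)$, acting by $T(\sum_Bv_Be_B)=\sum_{A,B}T_A(v_B)e_Ae_B$, with norm $\|T\|=\sum_A\|T_A\|_{\mathcal{B}(V)}$; $a\in\mathbb{R}_5$ is identified with $a\mathcal{I}$. $\mathcal{BC}^{0,1}(V_5)$ is the set of $T=T_0+\sum_{j=1}^5e_jT_j$ with pairwise commuting $T_j\in\mathcal{B}(V)$; $\overline{T}=T_0-\sum_{j=1}^5e_jT_j$. $\mathcal{Q}_{c,s}(T)=s^2\mathcal{I}-s(T+\overline{T})+T\overline{T}$; $\rho_S(T)$ is the set of $s\in\mathbb{R}^6$ for which it is invertible. Resolvent operators for $s\in\rho_S(T)$, writing $Q=\mathcal{Q}_{c,s}(T)$: $S^{-1}_{\mathcal{D},L}=S^{-1}_{\mathcal{D},R}=-4Q^{-1}$; $S^{-1}_{\Delta,L}=-8(s-\overline{T})Q^{-2}$, $S^{-1}_{\Delta,R}=-8Q^{-2}(s-\overline{T})$;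 $S^{-1}_{\Delta\mathcal{D},L}=S^{-1}_{\Delta\mathcal{D},R}=16Q^{-2}$; $S^{-1}_{\mathcal{D}^2,L}=-8(s-T)Q^{-2}$, $S^{-1}_{\mathcal{D}^2,R}=-8Q^{-2}(s-T)$; $S^{-1}_{\overline{\mathcal{D}},L}=4(s-\overline{T})Q^{-2}(s-T_0)+2Q^{-1}$, $S^{-1}_{\overline{\mathcal{D}},R}=4(s-T_0)Q^{-2}(s-\overline{T})+2Q^{-1}$; $S^{-1}_{\overline{\mathcal{D}}^2,L}=32(s-\overline{T})Q^{-3}(s-T_0)^2$, $S^{-1}_{\overline{\mathcal{D}}^2,R}=32(s-T_0)^2Q^{-3}(s-\overline{T})$; $S^{-1}_{\Delta\overline{\mathcal{D}},L}=-64(s-\overline{T})Q^{-3}(s-T_0)$, $S^{-1}_{\Delta\overline{\mathcal{D}},R}=-64(s-T_0)Q^{-3}(s-\overline{T})$ (all evaluated at $(s,T)$). *)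

(* Defs.v *)
From HB Require Import structures.
From mathcomp Require Import all_boot all_order all_algebra.
From mathcomp Require Import ring.
From mathcomp Require Import all_classical all_reals all_analysis.
Set Implicit Arguments.
Unset Strict Implicit.
Unset Printing Implicit Defensive.
Import Order.TTheory GRing.Theory Num.Theory.
Import numFieldNormedType.Exports.
Local Open Scope classical_set_scope.
Local Open Scope ring_scope.

Section BoundedOperators.
Context {R : realType} (V : normedModType R).

Definition bounded_linear : {pred V -> V} :=
  fun f => `[< linear f /\ exists M : R, forall x, `|f x| <= M * `|x| >].

Record bop := Bop { bopfun :> V -> V; _ : bopfun \in bounded_linear }.

HB.instance Definition _ := [isSub for bopfun].
HB.instance Definition _ := [Choice of bop by <:].

Lemma bounded_linearP f : reflect
  (linear f /\ exists M : R, forall x, `|f x| <= M * `|x|)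
  (f \in bounded_linear).
Proof. exact: asboolP. Qed.

Lemma bounded_linear_submod : submod_closed bounded_linear.
Proof.
split=> [|a f g /bounded_linearP[lf [M fM]] /bounded_linearP[lg [N gN]]].
  apply/bounded_linearP; split.
    by move=> a x y; rewrite scaler0 addr0.
  by exists 0 => x; rewrite normr0 mul0r.
apply/bounded_linearP; split.
  move=> b x y.
  rewrite (_ : (a *: f + g) (b *: x + y) =
    a *: f (b *: x + y) + g (b *: x + y))//.
  rewrite lf lg (_ : (a *: f + g) x = a *: f x + g x)//.
  rewrite (_ : (a *: f + g) y = a *: f y + g y)//.
  by rewrite !scalerDr !scalerA mulrC -!addrA; congr (_ + _); rewrite addrCA.
exists (`|a| * M + N) => x.
rewrite (_ : (a *: f + g) x = a *: f x + g x)//.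
rewrite (le_trans (ler_normD _ _))// mulrDl lerD// normrZ -mulrA.
by rewrite ler_wpM2l.
Qed.

HB.instance Definition _ := GRing.isSubmodClosed.Build R (V -> V)
  bounded_linear bounded_linear_submod.
HB.instance Definition _ := [SubChoice_isSubLmodule of bop by <:].

Lemma bop_linear (f : bop) : linear f.
Proof. by case: f => f /= /bounded_linearP[]. Qed.

HB.instance Definition _ (f : bop) :=
  GRing.isLinear.Build R V V *:%R (bopfun f) (bop_linear f).

Lemma bop_ext (f g : bop) : f =1 g -> f = g.
Proof. by move=> fg; apply: val_inj; apply/funext. Qed.

Lemma bop0E x : (0 : bop) x = 0. Proof. by []. Qed.
Lemma bopDE (f g : bop) x : (f + g) x = f x + g x. Proof. by []. Qed.
Lemma bopZE a (f : bop) x : (a *: f) x = a *: f x. Proof. by []. Qed.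

Lemma bop_bounded (f : bop) : exists M : R, forall x, `|f x| <= M * `|x|.
Proof. by case: f => f /= /bounded_linearP[]. Qed.

Lemma bop_id_subproof : (id : V -> V) \in bounded_linear.
Proof.
by apply/bounded_linearP; split=> //; exists 1 => x; rewrite mul1r.
Qed.

Lemma bop_comp_subproof (f g : bop) : (f \o g : V -> V) \in bounded_linear.
Proof.
apply/bounded_linearP; split=> [a x y|]; first by rewrite /= !linearP.
have [[M fM] [N gN]] := (bop_bounded f, bop_bounded g).
exists (`|M| * N) => x; rewrite -mulrA.
apply: (le_trans (fM _)); apply: (@le_trans _ _ (`|M| * `|g x|)).
  by rewrite ler_wpM2r// ler_norm.
by rewrite ler_wpM2l.
Qed.

Definition bop_id := Bop bop_id_subproof.
Definition bop_comp f g := Bop (bop_comp_subproof f g).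

Lemma bop_compA : associative bop_comp.
Proof. by move=> f g h; apply: bop_ext. Qed.
Lemma bop_comp1l : left_id bop_id bop_comp.
Proof. by move=> f; apply: bop_ext. Qed.
Lemma bop_comp1r : right_id bop_id bop_comp.
Proof. by move=> f; apply: bop_ext. Qed.
Lemma bop_compDl : left_distributive bop_comp +%R.
Proof. by move=> f g h; apply: bop_ext. Qed.
Lemma bop_compDr : right_distributive bop_comp +%R.
Proof. by move=> f g h; apply: bop_ext => x; exact: linearD. Qed.

HB.instance Definition _ := GRing.Zmodule_isPzRing.Build bop
  bop_compA bop_comp1l bop_comp1r bop_compDl bop_compDr.

Definition opnorm (f : bop) : R := sup [set `|f x| | x in [set x | `|x| <= 1]].

Lemma opnorm_has_sup (f : bop) :
  has_sup [set `|f x| | x in [set x | `|x| <= 1]].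
Proof.
split; first by exists `|f 0|, 0 => //=; rewrite normr0.
have [M fM] := bop_bounded f; exists `|M| => _ [x /= x1 <-].
rewrite (le_trans (fM x))// (le_trans (ler_norm _))// normrM normr_id.
by rewrite ler_piMr.
Qed.

Lemma le_opnorm1 (f : bop) x : `|x| <= 1 -> `|f x| <= opnorm f.
Proof.
by move=> x1; apply: ub_le_sup; [have [] := opnorm_has_sup f|exists x].
Qed.

Lemma opnorm_le (f : bop) M :
  (forall x, `|x| <= 1 -> `|f x| <= M) -> opnorm f <= M.
Proof.
move=> fM; apply: ge_sup; first by have [] := opnorm_has_sup f.
by move=> _ [x /= x1 <-]; exact: fM.
Qed.

Lemma opnorm_ge0 f : 0 <= opnorm f.
Proof. by rewrite (le_trans _ (@le_opnorm1 f 0 _))// normr0. Qed.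

Lemma le_opnorm (f : bop) x : `|f x| <= opnorm f * `|x|.
Proof.
have [->|x0] := eqVneq x 0; first by rewrite linear0 !normr0 mulr0.
have nx : 0 < `|x| by rewrite normr_gt0.
rewrite -ler_pdivrMr// mulrC.
rewrite -(ger0_norm (_ : 0 <= `|x|^-1)) ?invr_ge0// -normrZ -linearZ.
by apply: le_opnorm1; rewrite normrZ normfV normr_id mulVf// gt_eqF.
Qed.

Lemma opnormD f g : opnorm (f + g) <= opnorm f + opnorm g.
Proof.
apply: opnorm_le => x x1; rewrite bopDE (le_trans (ler_normD _ _))//.
by rewrite lerD// le_opnorm1.
Qed.

Lemma opnormZ a f : opnorm (a *: f) = `|a| * opnorm f.
Proof.
have le b g : opnorm (b *: g) <= `|b| * opnorm g.
  by apply: opnorm_le => x x1; rewrite bopZE normrZ ler_wpM2l// le_opnorm1.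
apply/eqP; rewrite eq_le le /=.
have [->|a0] := eqVneq a 0; first by rewrite normr0 mul0r opnorm_ge0.
have := le a^-1 (a *: f); rewrite scalerA mulVf// scale1r => /le_trans.
by rewrite -ler_pdivlMl ?normr_gt0// -normfV; exact.
Qed.

Lemma opnorm_eq0 f : opnorm f = 0 -> f = 0.
Proof.
move=> f0; apply: bop_ext => x; apply/eqP; rewrite -normr_le0.
by rewrite (le_trans (le_opnorm f x))// f0 mul0r.
Qed.

HB.instance Definition _ :=
  Lmodule_isNormed.Build R bop opnormD opnormZ opnorm_eq0.

End BoundedOperators.

Local Notation blade := {set 'I_5}.

(* [x : cliff A] is the formal sum of the x_S e_S, where S ranges over the
   subsets of 'I_5, 0-based, so that A = R, V, bop V give respectively the
   Clifford algebra, the two-sided Clifford module over V, and the operators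
   with components in bop V. *)
Definition cliff (A : Type) := {ffun blade -> A}.

HB.instance Definition _ (A : choiceType) := Choice.on (cliff A).
HB.instance Definition _ (A : zmodType) := GRing.Zmodule.on (cliff A).
HB.instance Definition _ (R : pzRingType) (A : lmodType R) :=
  GRing.Lmodule.on (cliff A).

Definition symdiff (S T : blade) : blade := ((S :\: T) :|: (T :\: S))%SET.

(* e_S e_T = bladesign S T e_(S symdiff T): each pair with t < s costs one
   transposition, and each common index a square e_i^2 = -1. *)
Definition bladesign (S T : blade) : int :=
  (-1) ^+ #|[set p : 'I_5 * 'I_5 |
              [&& p.1 \in S, p.2 \in T & (p.2 <= p.1)%N]]%SET|.

Definition clprod (A B C : zmodType) (f : A -> B -> C)
    (x : cliff A) (y : cliff B) : cliff C :=
  [ffun U => \sum_S \sum_(T | symdiff S T == U) f (x S) (y T) *~ bladesign S T].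

Lemma in_symdiff (S T : blade) i : (i \in symdiff S T) = (i \in S) (+) (i \in T).
Proof. by rewrite !inE; case: (i \in S); case: (i \in T). Qed.

Lemma symdiffA : associative symdiff.
Proof. by move=> S T U; apply/setP => i; rewrite !in_symdiff addbA. Qed.
Lemma symdiffC : commutative symdiff.
Proof. by move=> S T; apply/setP => i; rewrite !in_symdiff addbC. Qed.
Lemma symdiff0l : left_id finset.set0 symdiff.
Proof. by move=> S; apply/setP => i; rewrite in_symdiff inE. Qed.
Lemma symdiff0r : right_id finset.set0 symdiff.
Proof. by move=> S; rewrite symdiffC symdiff0l. Qed.
Lemma symdiffK S : cancel (symdiff S) (symdiff S).
Proof. by move=> T; apply/setP => i; rewrite !in_symdiff addKb. Qed.
Lemma symdiffxx S : symdiff S S = finset.set0.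
Proof. by rewrite -{2}(symdiff0r S) symdiffK. Qed.
Lemma symdiff_eq S T U : (symdiff S T == U) = (T == symdiff S U).
Proof. by apply/eqP/eqP => [<-|->]; rewrite symdiffK. Qed.

Lemma bladesignE S T : bladesign S T =
  \prod_(p : 'I_5 * 'I_5)
    (-1) ^+ [&& p.1 \in S, p.2 \in T & (p.2 <= p.1)%N].
Proof.
rewrite /bladesign -sum1_card expr_sum big_mkcond /=; apply: eq_bigr => p _.
by rewrite inE; case: [&& _, _ & _].
Qed.

Lemma bladesignDl S T U :
  bladesign (symdiff S T) U = bladesign S U * bladesign T U.
Proof.
rewrite !bladesignE -big_split; apply: eq_bigr => p _ /=.
by rewrite in_symdiff andb_addl signr_addb.
Qed.

Lemma bladesignDr S T U :
  bladesign U (symdiff S T) = bladesign U S * bladesign U T.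
Proof.
rewrite !bladesignE -big_split; apply: eq_bigr => p _ /=.
by rewrite in_symdiff andb_addl andb_addr signr_addb.
Qed.

Lemma bladesign0l S : bladesign finset.set0 S = 1.
Proof. by rewrite bladesignE big1// => p _; rewrite inE. Qed.

Lemma bladesign0r S : bladesign S finset.set0 = 1.
Proof. by rewrite bladesignE big1// => p _; rewrite inE andbF. Qed.

Lemma bladesign_sqr S T : bladesign S T * bladesign S T = 1.
Proof. by rewrite -expr2 sqrr_sign. Qed.

Lemma cliffMzE (A : zmodType) (x : cliff A) n U : (x *~ n) U = x U *~ n.
Proof.
have evB : zmod_morphism (fun x : cliff A => x U).
  by move=> y z; rewrite !ffunE.
pose ev : {additive cliff A -> A} := HB.pack (fun x : cliff A => x U)
  (GRing.isZmodMorphism.Build _ _ _ evB).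
exact: (raddfMz ev).
Qed.

Lemma bladesign1 i j : bladesign [set i]%SET [set j]%SET = (-1) ^+ (j <= i)%N.
Proof.
rewrite bladesignE (bigD1 (i, j))//= big1 ?mulr1 ?inE ?eqxx//.
move=> [a b] /=; rewrite !inE xpair_eqE andbA => /negbTE ->.
by rewrite expr0.
Qed.

Lemma clprodE (A B C : zmodType) (f : A -> B -> C) x y U :
  clprod f x y U =
  \sum_S f (x S) (y (symdiff S U)) *~ bladesign S (symdiff S U).
Proof.
rewrite ffunE; apply: eq_bigr => S _.
by under eq_bigl do rewrite symdiff_eq; rewrite big_pred1_eq.
Qed.

Lemma clprod_assoc (A B C D E F : zmodType) (f : A -> B -> D)
    (h : D -> C -> E) (g : B -> C -> F) (k : A -> F -> E) :
  (forall c, zmod_morphism (h^~ c)) -> (forall a, zmod_morphism (k a)) ->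
  (forall a b c, h (f a b) c = k a (g b c)) ->
  forall x y z,
    clprod h (clprod f x y) z = clprod k x (clprod g y z).
Proof.
move=> hD kD hk x y z; apply/ffunP => U; rewrite !clprodE.
pose H c : {additive D -> E} :=
  HB.pack (h^~ c) (GRing.isZmodMorphism.Build _ _ (h^~ c) (hD c)).
pose K a : {additive F -> E} :=
  HB.pack (k a) (GRing.isZmodMorphism.Build _ _ (k a) (kD a)).
have Hsum c I r (G : I -> D) : h (\sum_(i <- r) G i) c = \sum_(i <- r) h (G i) c.
  exact: (raddf_sum (H c)).
have Ksum a I r (G : I -> F) : k a (\sum_(i <- r) G i) = \sum_(i <- r) k a (G i).
  exact: (raddf_sum (K a)).
have HMz c d n : h (d *~ n) c = h d c *~ n by exact: (raddfMz (H c)).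
have KMz a d n : k a (d *~ n) = k a d *~ n by exact: (raddfMz (K a)).
transitivity (\sum_S \sum_W
  h (f (x W) (y (symdiff W S))) (z (symdiff S U)) *~
    (bladesign W (symdiff W S) * bladesign S (symdiff S U))).
  apply: eq_bigr => S _; rewrite clprodE Hsum mulrz_suml.
  by apply: eq_bigr => W _; rewrite HMz -mulrzA.
rewrite exchange_big; apply: eq_bigr => W _ /=.
rewrite clprodE Ksum mulrz_suml.
rewrite (reindex_inj (can_inj (symdiffK W))); apply: eq_bigr => S _ /=.
rewrite KMz -mulrzA hk symdiffK.
rewrite [symdiff S (symdiff W U)]symdiffA [symdiff S W]symdiffC.
congr (_ *~ _); rewrite -[RHS]mul1r -(bladesign_sqr W S).
by rewrite !bladesignDl !bladesignDr; ring.
Qed.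

Lemma clprodDl (A B C : zmodType) (f : A -> B -> C) :
  (forall b, {morph f^~ b : x y / x + y}) ->
  forall z, {morph (clprod f)^~ z : x y / x + y}.
Proof.
move=> fD z x y; apply/ffunP => U; rewrite [RHS]ffunE !clprodE -big_split.
by apply: eq_bigr => S _; rewrite ffunE fD mulrzDl.
Qed.

Lemma clprodDr (A B C : zmodType) (f : A -> B -> C) :
  (forall a, {morph f a : x y / x + y}) ->
  forall z, {morph clprod f z : x y / x + y}.
Proof.
move=> fD z x y; apply/ffunP => U; rewrite [RHS]ffunE !clprodE -big_split.
by apply: eq_bigr => S _; rewrite ffunE fD mulrzDl.
Qed.

(* [clblade a S] is the element a e_S. *)
Definition clblade (A : zmodType) (a : A) (S : blade) : cliff A :=
  [ffun T => if T == S then a else 0].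

Lemma clprod_blade0l (A B C : zmodType) (f : A -> B -> C) a y U :
  (forall b, f 0 b = 0) -> clprod f (clblade a finset.set0) y U = f a (y U).
Proof.
move=> f0; rewrite clprodE (bigD1 finset.set0)//= big1 ?addr0; last first.
  by move=> S S0; rewrite ffunE (negbTE S0) f0 mul0rz.
by rewrite ffunE eqxx symdiff0l bladesign0l.
Qed.

Lemma clprod_blade0r (A B C : zmodType) (f : A -> B -> C) x b U :
  (forall a, f a 0 = 0) -> clprod f x (clblade b finset.set0) U = f (x U) b.
Proof.
move=> f0; rewrite clprodE (bigD1 U)//= big1 ?addr0; last first.
  move=> S SU; rewrite ffunE symdiff_eq symdiff0r eq_sym (negbTE SU).
  by rewrite f0 mul0rz.
by rewrite ffunE symdiff_eq symdiff0r eqxx symdiffxx bladesign0r.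
Qed.

Section CliffRing.
Context {A : pzRingType}.

Definition cliff_one : cliff A := clblade 1 finset.set0.
Definition cliff_mul : cliff A -> cliff A -> cliff A := clprod *%R.

Lemma cliff_mulA : associative cliff_mul.
Proof.
move=> x y z; apply/esym/clprod_assoc => [c a b|c a b|a b c].
- exact: mulrBl.
- exact: mulrBr.
- by rewrite mulrA.
Qed.
Lemma cliff_mul1l : left_id cliff_one cliff_mul.
Proof.
move=> x; apply/ffunP => U.
by rewrite [LHS]clprod_blade0l ?mul1r// => b; rewrite mul0r.
Qed.
Lemma cliff_mul1r : right_id cliff_one cliff_mul.
Proof.
move=> x; apply/ffunP => U.
by rewrite [LHS]clprod_blade0r ?mulr1// => b; rewrite mulr0.
Qed.
Lemma cliff_mulDl : left_distributive cliff_mul +%R.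
Proof. by move=> x y z; apply: clprodDl => c a b; rewrite mulrDl. Qed.
Lemma cliff_mulDr : right_distributive cliff_mul +%R.
Proof. by move=> x y z; apply: clprodDr => c a b; rewrite mulrDr. Qed.

HB.instance Definition _ := GRing.Zmodule_isPzRing.Build (cliff A)
  cliff_mulA cliff_mul1l cliff_mul1r cliff_mulDl cliff_mulDr.

End CliffRing.

Lemma cliff_mulbladeE (A : pzRingType) (a b : A) (S T : blade) :
  clblade a S * clblade b T = clblade (a * b) (symdiff S T) *~ bladesign S T.
Proof.
apply/ffunP => U; rewrite [LHS]clprodE (bigD1 S)//= big1 ?addr0; last first.
  by move=> W WS; rewrite ffunE (negbTE WS) mul0r mul0rz.
rewrite cliffMzE !ffunE eqxx symdiff_eq.
case: eqVneq => [->|_]; last by rewrite mulr0 !mul0rz.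
by rewrite symdiffK.
Qed.

Lemma cliff_gen_sqr (A : pzRingType) (i : 'I_5) :
  clblade 1 [set i]%SET * clblade 1 [set i]%SET = -1 :> cliff A.
Proof.
by rewrite cliff_mulbladeE mulr1 symdiffxx bladesign1 leqnn mulrNz.
Qed.

Lemma cliff_gen_anticomm (A : pzRingType) (i j : 'I_5) : i != j ->
  clblade 1 [set i]%SET * clblade 1 [set j]%SET =
  - (clblade 1 [set j]%SET * clblade 1 [set i]%SET) :> cliff A.
Proof.
move=> ij; rewrite !cliff_mulbladeE mulr1 symdiffC !bladesign1 -mulrNz.
by case: ltngtP (ij) => // /val_inj ->; rewrite eqxx.
Qed.

Section CliffNorm.
Context {R : realType} (A : normedModType R).

Definition clnorm (x : cliff A) : R := \sum_S `|x S|.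

Lemma clnormD x y : clnorm (x + y) <= clnorm x + clnorm y.
Proof.
by rewrite -big_split; apply: ler_sum => S _; rewrite ffunE ler_normD.
Qed.

Lemma clnormZ a x : clnorm (a *: x) = `|a| * clnorm x.
Proof.
by rewrite mulr_sumr; apply: eq_bigr => S _; rewrite ffunE normrZ.
Qed.

Lemma clnorm_eq0 x : clnorm x = 0 -> x = 0.
Proof.
move=> /eqP; rewrite psumr_eq0// => /allP x0; apply/ffunP => S.
by apply/eqP; rewrite ffunE -normr_eq0; apply: x0; rewrite mem_index_enum.
Qed.

HB.instance Definition _ :=
  Lmodule_isNormed.Build R (cliff A) clnormD clnormZ clnorm_eq0.

End CliffNorm.

Section Operators.
Context {R : realType} {V : normedModType R}.

(* clact1, clactM and clact_inj identify the ring cliff (bop V) with the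
   operators it induces on cliff V, the product being the composition. *)
Definition clact : cliff (bop V) -> cliff V -> cliff V :=
  clprod (fun (f : bop V) v => f v).

Lemma clact1 v : clact 1 v = v.
Proof. by apply/ffunP => U; rewrite [LHS]clprod_blade0l. Qed.

Lemma clactM S T v : clact (S * T) v = clact S (clact T v).
Proof.
by apply: clprod_assoc => // f x y; rewrite linearB.
Qed.

Lemma clact_inj S T : clact S =1 clact T -> S = T.
Proof.
move=> ST; apply/ffunP => U; apply: bop_ext => v.
have /ffunP/(_ U) := ST (clblade v finset.set0).
by rewrite !clprod_blade0r// => f; rewrite linear0.
Qed.

End Operators.

Section Resolvents.
Context {R : realType} {V : normedModType R}.

Definition cliff_op (a : cliff R) : cliff (bop V) := 
  [ffun S => a S *: (1 : bop V)].

Lemma clact_cliff_op a v : clact (cliff_op a) v = clprod *:%R a v.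
Proof.
by apply/ffunP => U; rewrite [LHS]clprodE [RHS]clprodE;
  apply: eq_bigr => S _; rewrite ffunE.
Qed.

Definition invertible (A : pzRingType) (x : A) : Prop :=
  exists y, x * y = 1 /\ y * x = 1.

(* Equal to 0 when x is not invertible. *)
Definition inverse (A : pzRingType) (x : A) : A :=
  xget 0 [set y | x * y = 1 /\ y * x = 1].

Definition paravec (A : zmodType) (x : 'I_6 -> A) : cliff A :=
  clblade (x ord0) finset.set0 +
  \sum_(j < 5) clblade (x (lift ord0 j)) [set j]%SET.

(* The library norm on 'rV[R]_6 is the supremum norm. *)
Definition euclidean_norm (s : 'rV[R]_6) : R :=
  Num.sqrt (\sum_i s ord0 i ^+ 2).

Definition paraop (s : 'rV[R]_6) : cliff (bop V) :=
  cliff_op (paravec (s ord0)).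

(* s^(- n), the inverse being taken in the Clifford algebra *)
Definition paraop_negpow (s : 'rV[R]_6) (n : nat) : cliff (bop V) :=
  cliff_op (inverse (paravec (s ord0)) ^+ n).

Definition BC01 : set (cliff (bop V)) :=
  [set T | exists t : 'I_6 -> bop V,
    (forall i j, t i * t j = t j * t i) /\ T = paravec t].

(* component0 and clconj are meant for elements of the form T_0 + sum_j e_j T_j;
   they discard the components of degree at least 2. *)
Definition component0 (T : cliff (bop V)) : cliff (bop V) :=
  clblade (T finset.set0) finset.set0.

Definition clconj (T : cliff (bop V)) : cliff (bop V) :=
  component0 T - \sum_(j < 5) clblade (T [set j]%SET) [set j]%SET.

Implicit Types (s : 'rV[R]_6) (T : cliff (bop V)).

Definition Qcs s T : cliff (bop V) :=
  paraop s ^+ 2 - paraop s * (T + clconj T) + T * clconj T.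

Definition rhoS T : set 'rV[R]_6 := [set s | invertible (Qcs s T)].

Definition S_D_L s T := (- 4) *: inverse (Qcs s T).

Definition S_D_R s T := (- 4) *: inverse (Qcs s T).

Definition S_Lap_L s T :=
  (- 8) *: ((paraop s - clconj T) * inverse (Qcs s T) ^+ 2).

Definition S_Lap_R s T :=
  (- 8) *: (inverse (Qcs s T) ^+ 2 * (paraop s - clconj T)).

Definition S_LapD_L s T := 16 *: inverse (Qcs s T) ^+ 2.

Definition S_LapD_R s T := 16 *: inverse (Qcs s T) ^+ 2.

Definition S_D2_L s T :=
  (- 8) *: ((paraop s - T) * inverse (Qcs s T) ^+ 2).

Definition S_D2_R s T :=
  (- 8) *: (inverse (Qcs s T) ^+ 2 * (paraop s - T)).

Definition S_Dbar_L s T :=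
  4 *: ((paraop s - clconj T) * inverse (Qcs s T) ^+ 2 *
        (paraop s - component0 T)) +
  2 *: inverse (Qcs s T).

Definition S_Dbar_R s T :=
  4 *: ((paraop s - component0 T) * inverse (Qcs s T) ^+ 2 *
        (paraop s - clconj T)) +
  2 *: inverse (Qcs s T).

Definition S_Dbar2_L s T :=
  32 *: ((paraop s - clconj T) * inverse (Qcs s T) ^+ 3 *
         (paraop s - component0 T) ^+ 2).

Definition S_Dbar2_R s T :=
  32 *: ((paraop s - component0 T) ^+ 2 * inverse (Qcs s T) ^+ 3 *
         (paraop s - clconj T)).

Definition S_LapDbar_L s T :=
  (- 64) *: ((paraop s - clconj T) * inverse (Qcs s T) ^+ 3 *
             (paraop s - component0 T)).

Definition S_LapDbar_R s T :=
  (- 64) *: ((paraop s - component0 T) * inverse (Qcs s T) ^+ 3 *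
             (paraop s - clconj T)).

End Resolvents.

Definition has_expansion (R : realType) (W : normedModType R)
    (x : W) (c : R) (m0 : nat) (f : nat -> W) : Prop :=
  cvgn (fun n => \sum_(m0 <= m < n) f m) /\
  x = c *: limn (fun n => \sum_(m0 <= m < n) f m).

(* Main.v *)
Require Import Defs.
From HB Require Import structures.
From mathcomp Require Import all_boot all_order all_algebra.
From mathcomp Require Import zify ring.
From mathcomp Require Import all_classical all_reals all_analysis.
Set Implicit Arguments.
Unset Strict Implicit.
Unset Printing Implicit Defensive.
Import Order.TTheory GRing.Theory Num.Theory.
Import numFieldNormedType.Exports.
Local Open Scope ring_scope.

(** Write [T'] for the Clifford conjugate of [T]. Its components commute, so [T]
    and [T'] commute, and [T + T' = 2 T_0] and [T T' = sum_i T_i^2] have no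
    Clifford part, hence commute with [s]. But [T] commutes neither with [s] nor
    with [Q = s^2 - s (T + T') + T T'], and the expansions cannot be computed in
    a commutative ring of Clifford operators.

    They can be computed one level higher. In the left expansions [T] and [T']
    always stand to the left of the powers of [s]. Let [x] and [y] be the left
    multiplications by [T] and [T'] and [u] the right multiplication by [s], as
    bounded operators on the Banach space of Clifford operators. These commute
    with each other, by associativity. On them one can expand formally
      [F_(p,q) = (u - x)^(-p) (u - y)^(-q) 1
        = sum_n sum_(a + b = n) C(a+p-1, a) C(b+q-1, b) x^a y^b u^(-n-p-q) 1],
    and [x^a y^b u^(-n) 1] is [T^a T'^b s^(-n)]. Right multiplication by [Q] also
    commutes with [x], [y] and [u], and it agrees with [(u - x) (u - y)] at the
    vector [1]; hence it agrees with it on all the vectors [F_(p,q)]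
    ([res_comm_eq0], [res_Q]), and its inverse raises both exponents by one. For
    the same reason twice the right multiplication by [s - T_0] acts as
    [(u - x) + (u - y)]. So the left resolvent operators are
      [-4 F_(1,1)], [-8 F_(2,1)], [16 F_(2,2)], [-8 F_(1,2)],
      [2 F_(2,0) + 4 F_(1,1)], [8 F_(1,2) + 16 F_(2,1) + 8 F_(3,0)] and
      [-32 F_(2,2) - 32 F_(3,1)],
    and the coefficients of the proposition are those of these combinations
    ([expansion_D] to [expansion_LapDbar]). The right expansions are the same
    statements with the sides of all multiplications exchanged. Invertibility of
    [Q] is a consequence: the left and the right versions of [F_(1,1)] are a left
    and a right inverse ([inverse_Q]).

    Convergence needs two facts. The space of Clifford operators over a Banach
    space is complete ([bop_complete], [cliff_complete]). And although the l^1
    norm of [s^(-1)] may exceed [1 / |s|], the norm of [s^(-n)] is at most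
    [6 / |s|^n], because the powers of a paravector are paravectors and the
    Euclidean norm is multiplicative on them ([sum_coord_paravec_pow]). The
    series are then dominated by the expansions of [(1 - r)^(-p-q)] at
    [r = |T| / |s| < 1]. *)

Local Notation blade := {set 'I_5}.

(** * Completeness of spaces of operators *)

Section Completeness.
Context {R : realType}.

Lemma cauchy_near (X : normedModType R) (F : set_system X) (e : R) :
  ProperFilter F -> cauchy F -> 0 < e ->
  exists f, \forall g \near F, `|f - g| <= e.
Proof.
move=> FF /cauchyP Fc e0; have [f Ff] := Fc e e0; exists f.
by move: Ff; rewrite -ball_normE; apply: filterS => g /ltW.
Qed.

(** Evaluation at a vector, and extraction of a Clifford component, are the
    maps to which this is applied: they provide the pointwise candidate for the
    limit of a Cauchy filter. *)
Lemma cauchy_lipschitz (X : normedModType R) (Y : completeNormedModType R)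
    (p : X -> Y) (k : R) (F : set_system X) :
  0 <= k -> (forall f g, `|p f - p g| <= k * `|f - g|) ->
  ProperFilter F -> cauchy F -> cvg (p @ F)%classic.
Proof.
move=> k0 pk FF Fc; apply/cauchy_cvgP/cauchyP => e e0.
have k1 : 0 < k + 1 by rewrite ltr_wpDl.
have [f Ff] := cauchy_near FF Fc (divr_gt0 e0 k1).
exists (p f); rewrite -ball_normE; apply: filterS Ff => g /= fg.
apply: (le_lt_trans (pk f g)); apply: (le_lt_trans (ler_wpM2l k0 fg)).
by rewrite mulrCA gtr_pMr// ltr_pdivrMr// mul1r ltrDl.
Qed.

Lemma cvg_dist_le (X Y : normedModType R) (p : X -> Y) (F : set_system X)
    (y l : Y) (c : R) :
  ProperFilter F -> (p @ F --> l)%classic ->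
  (\forall f \near F, `|y - p f| <= c) -> `|y - l| <= c.
Proof.
move=> FF pl yc; apply/ler_addgt0Pr => e e0.
near F => f; rewrite -(subrK (p f) y) -addrA (le_trans (ler_normD _ _))// lerD//.
  by near: f.
by rewrite distrC; near: f; exact: (@cvgr_dist_le _ _ _ F _ p l pl e e0).
Unshelve. all: by end_near. Qed.

(** The pointwise limit [L] inherits linearity from the operators of the filter;
    the Cauchy condition bounds its distance to one of them in operator norm,
    which gives both its boundedness and the convergence in norm. *)
Lemma bop_complete (V : completeNormedModType R) (F : set_system (bop V)) :
  ProperFilter F -> cauchy F -> cvg F.
Proof.
move=> FF Fc.
have bopB (f g : bop V) x : (f - g) x = f x - g x by [].
have Fx x : cvg ((fun f : bop V => f x) @ F)%classic.
  apply: (@cauchy_lipschitz _ _ _ `|x|) => // f g.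
  by rewrite -bopB mulrC le_opnorm.
pose L x := lim ((fun f : bop V => f x) @ F)%classic.
have Lapprox e : 0 < e -> exists f,
    (\forall g \near F, `|f - g| <= e) /\ forall x, `|f x - L x| <= e * `|x|.
  move=> e0; have [f Ff] := cauchy_near FF Fc e0; exists f; split=> // x.
  apply: (cvg_dist_le FF (Fx x)); apply: filterS Ff => g fg.
  by rewrite -bopB (le_trans (le_opnorm _ _))// ler_wpM2r.
have Llin : linear L.
  move=> a x y; apply: cvg_lim => //.
  rewrite (_ : (fun f : bop V => f (a *: x + y)) =
      (fun f : bop V => a *: f x + f y)); last first.
    by apply/funext => f; rewrite linearP.
  by apply: cvgD; [apply: cvgZr; exact: Fx|exact: Fx].
have Lbnd : L \in @bounded_linear _ V.
  apply/bounded_linearP; split=> //.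
  have [f [_ fL]] := Lapprox 1 ltr01.
  exists (`|f| + 1) => x; rewrite -[L x](subKr (f x)).
  by rewrite (le_trans (ler_normB _ _))// mulrDl lerD// ?fL// le_opnorm.
apply/cvg_ex; exists (Bop Lbnd); apply/cvgrPdist_le => e e0.
have [f [Ff fL]] := Lapprox (e / 2) (divr_gt0 e0 (ltr0n _ 2)).
near=> g; rewrite -(subrK f (Bop Lbnd)) -addrA (splitr e).
rewrite (le_trans (ler_normD _ _))// lerD//; last by near: g.
apply: opnorm_le => x x1; rewrite bopB distrC (le_trans (fL x))//.
by rewrite ler_piMr// divr_ge0// ltW.
Unshelve. all: by end_near. Qed.

HB.instance Definition _ (V : completeNormedModType R) :=
  Uniform_isComplete.Build (bop V) (@bop_complete V).

Lemma cliff_complete (A : completeNormedModType R) (F : set_system (cliff A)) :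
  ProperFilter F -> cauchy F -> cvg F.
Proof.
move=> FF Fc.
have FS S : cvg ((fun f : cliff A => f S) @ F)%classic.
  apply: (@cauchy_lipschitz _ _ _ 1) => // f g.
  rewrite mul1r /Num.norm/= /clnorm (bigD1 S)//= !ffunE lerDl.
  exact: sumr_ge0.
pose L : cliff A := [ffun S => lim ((fun f : cliff A => f S) @ F)%classic].
have n0 : (0 : R) < #|{: blade}|%:R.
  by rewrite ltr0n; apply/card_gt0P; exists finset.set0.
apply/cvg_ex; exists L; apply/cvgrPdist_le => e e0.
have : \forall f \near F, forall S,
    `|L S - (f : cliff A) S| <= e / #|{: blade}|%:R.
  apply: filter_forall => S; rewrite ffunE.
  by apply: (@cvgr_dist_le _ _ _ F _ _ _ (FS S)); rewrite divr_gt0.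
apply: filterS => f Lf; rewrite /Num.norm/= /clnorm.
apply: (@le_trans _ _ (\sum_(S : blade) e / #|{: blade}|%:R)).
  by apply: ler_sum => S _; rewrite !ffunE; have := Lf S; rewrite ffunE.
rewrite sumr_const -[X in _ <= X](@divfK _ #|{: blade}|%:R) ?gt_eqF//.
by rewrite mulr_natr.
Qed.

HB.instance Definition _ (A : completeNormedModType R) :=
  Uniform_isComplete.Build (cliff A) (@cliff_complete A).

End Completeness.

(** * The normed algebra of Clifford operators *)

Section CliffordOperators.
Context {R : realType} {V : normedModType R}.
Local Notation cbop := (cliff (bop V)).
Implicit Types (a b c : cbop) (k : R).

Lemma bop_normM (f g : bop V) : `|f * g| <= `|f| * `|g|.
Proof.
apply: opnorm_le => x x1; apply: (le_trans (le_opnorm f _)).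
by apply: ler_wpM2l; [exact: opnorm_ge0|exact: le_opnorm1].
Qed.

Lemma bop_norm1 : `|1 : bop V| <= 1.
Proof. exact: opnorm_le. Qed.

Lemma bop_scaleAl k (f g : bop V) : k *: (f * g) = k *: f * g.
Proof. exact: bop_ext. Qed.

Lemma bop_scaleAr k (f g : bop V) : k *: (f * g) = f * (k *: g).
Proof. by apply: bop_ext => x; rewrite bopZE; apply/esym; exact: linearZ. Qed.

Lemma cliff_scaleAl k a b : k *: (a * b) = k *: a * b.
Proof.
apply/ffunP => U; rewrite ffunE [X in _ *: X]clprodE [RHS]clprodE scaler_sumr.
by apply: eq_bigr => S _; rewrite ffunE -scalerMzr bop_scaleAl.
Qed.

Lemma cliff_scaleAr k a b : k *: (a * b) = a * (k *: b).
Proof.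
apply/ffunP => U; rewrite ffunE [X in _ *: X]clprodE [RHS]clprodE scaler_sumr.
by apply: eq_bigr => S _; rewrite ffunE -scalerMzr bop_scaleAr.
Qed.

Lemma cliff_normE (A : normedModType R) (x : cliff A) : `|x| = \sum_S `|x S|.
Proof. by []. Qed.

Lemma normMz_bladesign (A : normedModType R) (x : A) S T :
  `|x *~ bladesign S T| = `|x|.
Proof.
by rewrite /bladesign -signr_odd; case: (odd _) => //=; rewrite mulrNz normrN.
Qed.

(** The product of two blades is a blade up to sign, so the product of the
    components expands the product of the l^1 norms term by term. *)
Lemma cliff_normM a b : `|a * b| <= `|a| * `|b|.
Proof.
rewrite !cliff_normE mulr_suml.
apply: (@le_trans _ _ (\sum_U \sum_S `|a S| * `|b (symdiff S U)|)).
  apply: ler_sum => U _; rewrite [X in `|X|]clprodE.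
  apply: (le_trans (ler_norm_sum _ _ _)); apply: ler_sum => S _.
  by rewrite normMz_bladesign bop_normM.
rewrite exchange_big/=; apply: ler_sum => S _.
by rewrite -mulr_sumr [in leRHS](reindex_inj (can_inj (symdiffK S))).
Qed.

End CliffordOperators.

Section CliffOp.
Context {R : realType} {V : normedModType R}.

Lemma cliff_op1 : cliff_op 1 = 1 :> cliff (bop V).
Proof.
by apply/ffunP => S; rewrite !ffunE; case: eqP; rewrite ?scale1r ?scale0r.
Qed.

Lemma cliff_opM (a b : cliff R) :
  cliff_op (a * b) = cliff_op a * cliff_op b :> cliff (bop V).
Proof.
apply/ffunP => U; rewrite ffunE [X in X *: _]clprodE [RHS]clprodE scaler_suml.
apply: eq_bigr => S _; rewrite !ffunE -bop_scaleAl mul1r scalerA.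
exact/esym/scalerMzl.
Qed.

Lemma cliff_opX (a : cliff R) n :
  cliff_op (a ^+ n) = cliff_op a ^+ n :> cliff (bop V).
Proof. by elim: n => [|n IH]; rewrite ?cliff_op1// !exprS cliff_opM IH. Qed.

Lemma cliff_op_norm (a : cliff R) :
  `|cliff_op a : cliff (bop V)| <= \sum_S `|a S|.
Proof.
rewrite cliff_normE; apply: ler_sum => S _.
by rewrite ffunE normrZ ler_piMr// bop_norm1.
Qed.

End CliffOp.

(** * Paravectors *)

Section ParavectorBlades.

(** The basis of the paravectors, [1, e_1, ..., e_5], as a subfamily of the
    blades: index [0] gives the empty blade. *)
Definition parablade (i : 'I_6) : blade :=
  if unlift ord0 i is Some j then [set j]%SET else finset.set0.

Lemma parablade0 : parablade ord0 = finset.set0.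
Proof. by rewrite /parablade unlift_none. Qed.

Lemma parablade_lift (j : 'I_5) : parablade (lift ord0 j) = [set j]%SET.
Proof. by rewrite /parablade liftK. Qed.

Lemma parablade_inj : injective parablade.
Proof.
move=> i j; rewrite /parablade.
case: unliftP => [i' ->|->]; case: unliftP => [j' ->|->] //.
- by move=> /finset.set1_inj ->.
- by move=> /setP/(_ i'); rewrite !inE eqxx.
- by move=> /setP/(_ j'); rewrite !inE eqxx.
Qed.

Context {A : zmodType}.
Implicit Type t : 'I_6 -> A.

Lemma paravecE t : paravec t = \sum_(i < 6) clblade (t i) (parablade i).
Proof.
rewrite big_ord_recl parablade0; congr (_ + _).
by apply: eq_bigr => j _; rewrite parablade_lift.
Qed.

Lemma paravec_coord t i : paravec t (parablade i) = t i.
Proof.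
rewrite paravecE sum_ffunE (bigD1 i)//= ffunE eqxx big1 ?addr0// => j ji.
by rewrite ffunE (inj_eq parablade_inj) eq_sym (negbTE ji).
Qed.

(** Only six components of a paravector can be nonzero, so that norms of
    paravectors are sums over six coordinates. *)
Lemma sum_paravec (B : zmodType) (F : A -> B) t : F 0 = 0 ->
  \sum_S F (paravec t S) = \sum_(i < 6) F (t i).
Proof.
move=> F0; rewrite (bigID (mem [set parablade i | i in 'I_6]%SET))/=.
rewrite addrC big1 ?add0r => [|S nS].
  rewrite big_imset/=; last by move=> i j _ _; exact: parablade_inj.
  by apply: eq_bigr => i _; rewrite paravec_coord.
rewrite paravecE sum_ffunE big1// => i _; rewrite ffunE.
by case: eqP nS => // ->; rewrite imset_f.
Qed.

End ParavectorBlades.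

(** The two mixed products of each pair of distinct terms cancel. *)
Lemma sumr_sqr_anticomm (B : pzRingType) (I : eqType) (r : seq I) (E : I -> B) :
  uniq r -> (forall i j, i != j -> E i * E j = - (E j * E i)) ->
  (\sum_(i <- r) E i) ^+ 2 = \sum_(i <- r) E i ^+ 2.
Proof.
move=> + EE; elim: r => [|i r IH] /=; first by rewrite !big_nil expr0n.
move=> /andP[ir /IH {}IH]; rewrite !big_cons -IH.
have -> : (\sum_(j <- r) E j) = - - (\sum_(j <- r) E j) by rewrite opprK.
rewrite [LHS]expr2 mulrDl !mulrDr.
have -> : E i * - - (\sum_(j <- r) E j) = - (- - (\sum_(j <- r) E j) * E i).
  rewrite opprK mulr_sumr mulr_suml -sumrN; apply: eq_big_seq => j jr.
  by apply: EE; apply: contraNneq ir => ->.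
by rewrite addrA addrNK -!expr2.
Qed.

Section ParavectorRing.
Context {A : pzRingType}.
Implicit Types (t : 'I_6 -> A) (k : A).

Definition clscalar k : cliff A := clblade k finset.set0.

Lemma clbladeN k S : clblade (- k) S = - clblade k S.
Proof. by apply/ffunP => U; rewrite !ffunE; case: eqP; rewrite ?oppr0. Qed.

Lemma clbladeD k k' S : clblade (k + k') S = clblade k S + clblade k' S.
Proof. by apply/ffunP => U; rewrite !ffunE; case: eqP; rewrite ?addr0. Qed.

Lemma clblade_sum I (r : seq I) (k : I -> A) S :
  clblade (\sum_(i <- r) k i) S = \sum_(i <- r) clblade (k i) S.
Proof.
apply: (big_morph (fun k => clblade k S)); first by move=> *; exact: clbladeD.
by apply/ffunP => U; rewrite !ffunE if_same.
Qed.

Lemma clscalar_blade k k' S : clscalar k * clblade k' S = clblade (k * k') S.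
Proof. by rewrite cliff_mulbladeE symdiff0l bladesign0l. Qed.

Lemma clblade_scalar k k' S : clblade k S * clscalar k' = clblade (k * k') S.
Proof. by rewrite cliff_mulbladeE symdiff0r bladesign0r. Qed.

Lemma clscalar_comm k (x : cliff A) :
  (forall S, GRing.comm k (x S)) -> GRing.comm (clscalar k) x.
Proof.
move=> kx; apply/ffunP => U; rewrite [LHS]clprod_blade0l => [|b]; last first.
  by rewrite mul0r.
by rewrite [RHS]clprod_blade0r => [|b]; [exact: kx|rewrite mulr0].
Qed.

(** The coordinates of the Clifford conjugate. *)
Definition paraconj t : 'I_6 -> A := fun i => if i == ord0 then t i else - t i.

Lemma paravec_conjE t : paravec (paraconj t) =
  clscalar (t ord0) - \sum_(j < 5) clblade (t (lift ord0 j)) [set j]%SET.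
Proof.
congr (_ + _); rewrite -sumrN; apply: eq_bigr => j _.
by rewrite /paraconj -clbladeN.
Qed.

Lemma paraconjK t : paraconj (paraconj t) =1 t.
Proof. by move=> i; rewrite /paraconj; case: eqP => // _; rewrite opprK. Qed.

Lemma paravec_addconj t :
  paravec t + paravec (paraconj t) = clscalar (t ord0 *+ 2).
Proof. by rewrite paravec_conjE addrACA subrr addr0 -clbladeD mulr2n. Qed.

(** With [t_0 + v] for the paravector, the product is [t_0^2 - v^2], and the
    square of the vector part is [- sum t_j^2] because the generators anticommute
    while the coordinates commute. *)
Lemma paravec_mulconj t : (forall i j, GRing.comm (t i) (t j)) ->
  paravec t * paravec (paraconj t) = clscalar (\sum_i t i ^+ 2).
Proof.
move=> tC; rewrite paravec_conjE /paravec; set v := \sum_(j < 5) _.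
have cv : clscalar (t ord0) * v = v * clscalar (t ord0).
  rewrite mulr_sumr mulr_suml; apply: eq_bigr => j _.
  by rewrite clscalar_blade clblade_scalar tC.
have v2 : v ^+ 2 = - clscalar (\sum_(j < 5) t (lift ord0 j) ^+ 2).
  rewrite /v sumr_sqr_anticomm ?index_enum_uniq//.
    rewrite /clscalar clblade_sum -sumrN; apply: eq_bigr => j _.
    by rewrite expr2 cliff_mulbladeE symdiffxx bladesign1 leqnn mulrNz.
  move=> i j ij; rewrite !cliff_mulbladeE symdiffC !bladesign1 -mulrNz tC.
  by case: ltngtP (ij) => // /val_inj ->; rewrite eqxx.
rewrite mulrDl !mulrDr -/(clscalar _) !mulrN cv addrA addrNK -(expr2 v) v2.
by rewrite opprK clscalar_blade -clbladeD [in RHS]big_ord_recl expr2.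
Qed.

Lemma paravec_conjmul t : (forall i j, GRing.comm (t i) (t j)) ->
  paravec (paraconj t) * paravec t = clscalar (\sum_i t i ^+ 2).
Proof.
move=> tC; have {2}<- : paraconj (paraconj t) = t by exact/funext/paraconjK.
rewrite paravec_mulconj; last first.
  move=> i j; rewrite /paraconj.
  by case: eqP => _; case: eqP => _; rewrite /GRing.comm ?mulrN ?mulNr tC.
congr clscalar; apply: eq_bigr => i _.
by rewrite /paraconj; case: eqP; rewrite ?sqrrN.
Qed.

Lemma clscalar_paravec k t : clscalar k * paravec t = paravec (fun i => k * t i).
Proof.
by rewrite !paravecE mulr_sumr; apply: eq_bigr => i _; rewrite clscalar_blade.
Qed.

End ParavectorRing.

Section RealParavectors.
Context {R : realType}.
Implicit Type z : 'I_6 -> R.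

Definition sqnorm z : R := \sum_i z i ^+ 2.

(** A paravector is a root of the quadratic polynomial whose coefficients are its
    trace and its squared norm: it spans a copy of the complex plane (or of the
    real line). *)
Lemma paravec_sqr z : paravec z ^+ 2 =
  clscalar (z ord0 *+ 2) * paravec z - clscalar (sqnorm z).
Proof.
rewrite -paravec_addconj -(paravec_conjmul (t := z)).
  by rewrite mulrDl addrK expr2.
by move=> i j; exact: mulrC.
Qed.

(** The powers of a paravector stay in the real span of [1] and of itself; the
    second equation is the multiplicativity of the Euclidean norm there. *)
Lemma paravec_pow z n : exists a b : R,
  paravec z ^+ n = clscalar a + clscalar b * paravec z /\
  a ^+ 2 + a * b * z ord0 *+ 2 + b ^+ 2 * sqnorm z = sqnorm z ^+ n.
Proof.
elim: n => [|n [a [b [IH N]]]].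
  exists 1, 0; rewrite !expr0; split; last by ring.
  rewrite (_ : clscalar 0 = 0) ?mul0r ?addr0//.
  by apply/ffunP => U; rewrite !ffunE if_same.
exists (- b * sqnorm z), (a + b * z ord0 *+ 2); split; last first.
  by rewrite (exprS (sqnorm z)) -N; ring.
rewrite exprSr IH mulrDl -mulrA -expr2 paravec_sqr mulrBr mulrA.
rewrite !clscalar_blade addrA -mulrDl -clbladeD -mulrnAr addrC; congr (_ + _).
by rewrite mulNr; exact/esym/clbladeN.
Qed.

(** The l^1 norm is not multiplicative, even on paravectors, and the radius of
    convergence [|s|] is Euclidean. A power is again a paravector whose Euclidean
    norm is the power of the norm; comparing norms once, after taking the power,
    costs the constant [6] and not [6^n]. *)
Lemma sum_coord_paravec_pow z n :
  \sum_S `|(paravec z ^+ n) S| <= 6 * Num.sqrt (sqnorm z) ^+ n.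
Proof.
have [a [b [E N]]] := paravec_pow z n.
pose t : 'I_6 -> R := fun i => (if i == ord0 then a else 0) + b * z i.
have -> : paravec z ^+ n = paravec t.
  rewrite E clscalar_paravec !paravecE.
  under [in RHS]eq_bigr do rewrite clbladeD.
  rewrite big_split/=; congr (_ + _).
  rewrite (bigD1 ord0)//= parablade0 big1 ?addr0// => i /negbTE ->.
  by apply/ffunP => U; rewrite !ffunE if_same.
have t2 : sqnorm t = Num.sqrt (sqnorm z) ^+ n ^+ 2.
  rewrite -exprM mulnC exprM sqr_sqrtr ?sumr_ge0// => [|i _]; last exact: sqr_ge0.
  rewrite -N /sqnorm !big_ord_recl !big_ord0 /t /=.
  by ring.
rewrite (sum_paravec (F := fun x => `|x|)) ?normr0//.
apply: (@le_trans _ _ (\sum_(i < 6) Num.sqrt (sqnorm z) ^+ n)).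
  apply: ler_sum => i _.
  rewrite -(@ler_pXn2r _ 2) ?nnegrE ?exprn_ge0 ?sqrtr_ge0// -t2.
  rewrite real_normK ?num_real// /sqnorm (bigD1 i)//= lerDl.
  by apply: sumr_ge0 => j _; exact: sqr_ge0.
by rewrite sumr_const card_ord mulr_natl.
Qed.

Definition parainv z : 'I_6 -> R := fun i => (sqnorm z)^-1 * paraconj z i.

Lemma paravec_inv z : sqnorm z != 0 ->
  paravec z * paravec (parainv z) = 1 /\ paravec (parainv z) * paravec z = 1.
Proof.
move=> z0; have zC i j : GRing.comm (z i) (z j) by exact: mulrC.
rewrite /parainv -clscalar_paravec; split.
  rewrite mulrA -(clscalar_comm (k := (sqnorm z)^-1)) => [|S]; last exact: mulrC.
  by rewrite -mulrA paravec_mulconj// clscalar_blade mulVf.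
by rewrite -mulrA paravec_conjmul// clscalar_blade mulVf.
Qed.

Lemma sqnorm_parainv z : sqnorm z != 0 -> sqnorm (parainv z) = (sqnorm z)^-1.
Proof.
move=> z0; transitivity ((sqnorm z)^-1 ^+ 2 * sqnorm z); last by field.
rewrite mulr_sumr; apply: eq_bigr => i _; rewrite exprMn; congr (_ * _).
by rewrite /paraconj; case: eqP; rewrite ?sqrrN.
Qed.

End RealParavectors.

Section ConjugateParavector.
Context {R : realType} {V : normedModType R}.
Implicit Type t : 'I_6 -> bop V.

Lemma cliff_op_comm (k : bop V) (a : cliff R) :
  GRing.comm (clscalar k) (cliff_op a).
Proof.
apply: clscalar_comm => S.
by rewrite ffunE /GRing.comm -bop_scaleAr -bop_scaleAl mulr1 mul1r.
Qed.

Lemma component0_paravec t : component0 (paravec t) = clscalar (t ord0).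
Proof. by rewrite /component0 -parablade0 paravec_coord parablade0. Qed.

Lemma clconj_paravec t : clconj (paravec t) = paravec (paraconj t).
Proof.
rewrite /clconj component0_paravec paravec_conjE; congr (_ - _).
by apply: eq_bigr => j _; rewrite -parablade_lift paravec_coord.
Qed.

Lemma norm_clconj t : `|clconj (paravec t)| = `|paravec t|.
Proof.
rewrite clconj_paravec !cliff_normE !(sum_paravec (F := fun x => `|x|)) ?normr0//.
by apply: eq_bigr => i _; rewrite /paraconj; case: eqP; rewrite ?normrN.
Qed.

End ConjugateParavector.

(** * Coefficients of the expansions *)

(** The coefficient of [z^a] in [(1 - z)^(-p)]. For [p = 0] the truncated
    predecessor makes it [1] at [a = 0] and [0] elsewhere, as it should be. *)
Definition negbin p a := 'C((a + p).-1, a).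

Lemma negbin0 a : negbin 0 a = (a == 0)%N.
Proof. by rewrite /negbin addn0; case: a => // a; rewrite bin_small. Qed.

Lemma negbin_S0 p : negbin p.+1 0 = negbin p 0.
Proof. by rewrite /negbin !bin0. Qed.

Lemma negbin_SS p a : negbin p.+1 a.+1 = (negbin p a.+1 + negbin p.+1 a)%N.
Proof. by rewrite /negbin !addSn !addnS/= binS. Qed.

Lemma negbin1 a : negbin 1 a = 1%N.
Proof. by rewrite /negbin addn1/= binn. Qed.

Lemma negbin2 a : negbin 2 a = a.+1.
Proof. by rewrite /negbin addn2/= binSn. Qed.

Lemma negbin3 a : (negbin 3 a * 2 = a.+2 * a.+1)%N.
Proof.
rewrite /negbin addn3/= -bin_sub; last by rewrite -addn2 leq_addr.
have -> : (a.+2 - a = 2)%N by lia.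
by rewrite bin2 muln2 halfK oddM/= andNb subn0.
Qed.

Section Homogeneous.
Context {B : pzRingType}.
Implicit Types x y z : B.

(** For commuting [x] and [y], the coefficient of [z^n] in
    [(1 - x z)^(-p) (1 - y z)^(-q)]. *)
Definition homog x y p q n : B :=
  \sum_(k < n.+1) (x ^+ (n - k) * y ^+ k) *+ (negbin p (n - k) * negbin q k).

Lemma homog00 x y n : homog x y 0 0 n = (n == 0)%N%:R.
Proof.
rewrite /homog; case: n => [|n]; first by rewrite big_ord1 !negbin0 !expr0 mulr1.
rewrite big1//= => -[k /= kn] _; rewrite !negbin0.
by case: k kn => [|k] kn; rewrite ?subn0 ?muln0 ?mulr0n.
Qed.

Lemma homog_at0 x y p q : homog x y p q 0 = 1.
Proof. by rewrite /homog big_ord1 /negbin !bin0 !expr0 mulr1. Qed.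

(** The generating function identity [(1 - x z) f_(p+1,q) = f_(p,q)], read on
    coefficients. *)
Lemma homogSl x y p q n :
  homog x y p.+1 q n.+1 = homog x y p q n.+1 + x * homog x y p.+1 q n.
Proof.
rewrite /homog big_ord_recr [in RHS]big_ord_recr /= -addrA [X in _ = _ + X]addrC.
rewrite addrA subnn negbin_S0; congr (_ + _).
rewrite mulr_sumr -big_split; apply: eq_bigr => -[k /=]; rewrite ltnS => kn _.
by rewrite subSn// negbin_SS mulnDl mulrnDr exprS mulrnAr !mulrA.
Qed.

Lemma homogC x y p q n : GRing.comm x y -> homog x y p q n = homog y x q p n.
Proof.
move=> xy; rewrite /homog (reindex_inj rev_ord_inj)/=.
apply: eq_bigr => -[k /=]; rewrite ltnS => kn _.
rewrite subSS subKn// mulnC; congr (_ *+ _).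
exact/commrX/commr_sym/commrX/commr_sym.
Qed.

Lemma comm_homog z x y p q n :
  GRing.comm z x -> GRing.comm z y -> GRing.comm z (homog x y p q n).
Proof.
move=> zx zy; apply: commr_sum => k _.
by apply: commrMn; apply: commrM; apply: commrX.
Qed.

End Homogeneous.

Section HomogeneousReal.
Context {R : realType}.

Lemma homog_ge0 (r : R) p q n : 0 <= r -> 0 <= homog r r p q n.
Proof.
by move=> r0; apply: sumr_ge0 => k _; rewrite mulrn_wge0// mulr_ge0// exprn_ge0.
Qed.

(** At real points the sums are bounded by the value [(1 - r)^(-p-q)] of the
    generating function. The recurrence [homogSl] gives
    [(1 - r) s_(p+1,q) <= s_(p,q)] for the partial sums, because their terms are
    nonnegative. *)
Lemma sum_homog_le (r : R) p q N : 0 <= r < 1 ->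
  \sum_(0 <= n < N) homog r r p q n <= (1 - r)^-1 ^+ (p + q).
Proof.
move=> /andP[r0 r1].
have step p' q' : (forall N', \sum_(0 <= n < N') homog r r p' q' n
      <= (1 - r)^-1 ^+ (p' + q')) -> forall N',
    \sum_(0 <= n < N') homog r r p'.+1 q' n <= (1 - r)^-1 ^+ (p'.+1 + q').
  move=> IH N'; rewrite addSn exprS ler_pdivlMl ?subr_gt0//.
  apply: le_trans (IH N'); rewrite mulrBl mul1r lerBlDr.
  case: N' => [|N']; first by rewrite !big_geq// mulr0 addr0.
  rewrite [X in X <= _]big_nat_recl// [X in _ <= X + _]big_nat_recl//.
  rewrite !homog_at0 -addrA lerD2l; under eq_bigr do rewrite homogSl.
  rewrite big_split/= lerD2l -mulr_sumr ler_wpM2l//.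
  by rewrite big_nat_recr//= lerDl homog_ge0.
elim: p N => [|p IH] N; last exact: step.
elim: q N => [|q IH] N.
  rewrite expr0; case: N => [|N]; first by rewrite big_geq.
  rewrite big_nat_recl//= homog_at0 big1 ?addr0// => i _.
  by rewrite homog00.
under eq_bigr do rewrite homogC//.
rewrite addnC; apply: step => N'.
by under eq_bigr do rewrite homogC//; rewrite addnC.
Qed.

Lemma is_cvg_homog (r : R) p q : 0 <= r < 1 -> cvgn (series (homog r r p q)).
Proof.
move=> r01; have /andP[r0 _] := r01; apply: nondecreasing_is_cvgn.
  by apply: nondecreasing_series => n _ _; exact: homog_ge0.
by exists ((1 - r)^-1 ^+ (p + q)) => _ [n _ <-]; exact: sum_homog_le.
Qed.

End HomogeneousReal.

Section ExpansionFromSeries.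
Context {R : realType} {X : normedModType R}.

Lemma bop_cvg (f : bop X) (v : nat -> X) (l : X) :
  (v @ \oo --> l)%classic -> ((fun n => f (v n)) @ \oo --> f l)%classic.
Proof.
move=> vl; apply/cvgrPdist_le => e e0.
have k1 : 0 < `|f| + 1 by rewrite ltr_wpDl.
near=> n; rewrite -linearB (le_trans (le_opnorm f _))//.
apply: (@le_trans _ _ ((`|f| + 1) * `|l - v n|)); first by rewrite ler_wpM2r ?lerDl.
rewrite -ler_pdivlMl// mulrC.
by near: n; apply: (@cvgr_dist_le _ _ _ _ _ _ _ vl); rewrite divr_gt0.
Unshelve. all: by end_near. Qed.

Lemma cvg_seriesD (f g : nat -> X) a b :
  (series f @ \oo --> a)%classic -> (series g @ \oo --> b)%classic ->
  (series (fun n => f n + g n) @ \oo --> a + b)%classic.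
Proof.
move=> fa gb; have -> : series (fun n => f n + g n) = series f + series g.
  by apply/funext => n; rewrite /series/= big_split.
exact: cvgD.
Qed.

Lemma cvg_seriesZ (c : R) (f : nat -> X) a :
  (series f @ \oo --> a)%classic ->
  (series (fun n => c *: f n) @ \oo --> c *: a)%classic.
Proof.
move=> fa; have -> : series (fun n => c *: f n) = c \*: series f.
  by apply/funext => n; rewrite /series/= scaler_sumr.
exact: cvgZl_tmp.
Qed.

Lemma has_expansion_series (c : R) m0 (f g : nat -> X) (l : X) :
  (series g @ \oo --> l)%classic -> (forall n, f (n + m0)%N = g n) ->
  has_expansion (c *: l) c m0 f.
Proof.
move=> gl fg.
have fl : ((fun n => \sum_(m0 <= m < n) f m) @ \oo --> l)%classic.
  rewrite -(cvg_shiftn m0); apply: cvg_trans gl; apply: near_eq_cvg.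
  near=> n; rewrite /series/= -{1}[m0]add0n big_addn addnK.
  by apply: eq_bigr => i _; rewrite fg.
by split; [exact: cvgP fl|congr (_ *: _); apply/esym/cvg_lim].
Unshelve. all: by end_near. Qed.

End ExpansionFromSeries.

Arguments bop_cvg {R X} f [v l] _ : rename.

Arguments has_expansion_series {R X} c m0 [f g l] _ _.
Arguments cvg_seriesZ {R X} c [f a] _.

(** * Resolvent series of commuting operators *)

Section BopEval.
Context {R : realType} {X : normedModType R}.
Implicit Types f g : bop X.

Lemma bopME f g z : (f * g) z = f (g z). Proof. by []. Qed.
Lemma bopBE f g z : (f - g) z = f z - g z. Proof. by []. Qed.
Lemma bopMnE f n z : (f *+ n) z = f z *+ n.
Proof. by elim: n => [|n IH]; rewrite ?mulr0n// !mulrS bopDE IH. Qed.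
Lemma bop_sumE I r (P : pred I) (F : I -> bop X) z :
  (\sum_(i <- r | P i) F i) z = \sum_(i <- r | P i) F i z.
Proof. by elim/big_rec2: _ => //= i y f _ <-. Qed.

End BopEval.

(** Commuting bounded operators [x], [y] and an invertible [u] with inverse [w],
    for which the expansions in powers of [x w] and [y w] converge at the vector
    [one]. The bound concerns the orbit of [one] under all three operators: in the
    intended instances the operator norm of [x w] can exceed [1]. *)
Record resolvent_data (R : realType) (X : normedModType R)
    (x y w u : bop X) (one : X) : Prop := ResolventData {
  res_xy : GRing.comm x y;
  res_xw : GRing.comm x w;
  res_yw : GRing.comm y w;
  res_ux : GRing.comm u x;
  res_uy : GRing.comm u y;
  res_uw : u * w = 1;
  res_wu : w * u = 1;
  res_bound : exists K r sigma : R, [/\ 0 <= r < 1, 0 <= sigma &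
    forall a b n, `|(x ^+ a * y ^+ b * w ^+ (a + b + n)) one|
      <= K * r ^+ (a + b) * sigma ^+ n] }.

Definition commute_data (R : realType) (X : normedModType R)
    (x y w E : bop X) : Prop :=
  [/\ GRing.comm E x, GRing.comm E y & GRing.comm E w].

Section ResolventSeries.
Context {R : realType} {X : completeNormedModType R}.
Implicit Types (x y w u : bop X) (one : X).

(** The term of degree [n] of the expansion of [(u - x)^(-p) (u - y)^(-q) one]
    in powers of [w]. *)
Definition resterm x y w one p q n : X :=
  (homog x y p q n * w ^+ (n + p + q)) one.

(** [res x y w one p q] plays the role of [(u - x)^(-p) (u - y)^(-q) one]: this is
    what [res00], [resSl] and [resSr] say. *)
Definition res x y w one p q : X := limn (series (resterm x y w one p q)).

Section Theory.
Context {x y w u : bop X} {one : X}.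
Hypothesis D : resolvent_data x y w u one.

Lemma resolvent_data_swap : resolvent_data y x w u one.
Proof.
case: D => xyC xw yw ux uy uw wu [K [r [sigma [r01 s0 bnd]]]]; split=> //.
exists K, r, sigma; split=> // a b n; rewrite [(a + b)%N]addnC.
have -> : y ^+ a * x ^+ b = x ^+ b * y ^+ a.
  exact/commrX/commr_sym/commrX.
exact: bnd.
Qed.

(** Termwise domination by [homog r r p q] at a real [r < 1]. *)
Lemma is_cvg_res p q : cvgn (series (resterm x y w one p q)).
Proof.
have [K [r [sigma [/[dup] r01 /andP[r0 _] s0 bnd]]]] := res_bound D.
apply: normed_cvg.
apply: (@series_le_cvg _ _
  (fun n => (`|K| * sigma ^+ (p + q)) *: homog r r p q n)).
- by move=> n /=.
- by move=> n; rewrite mulr_ge0 ?homog_ge0 ?mulr_ge0// exprn_ge0.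
- move=> n /=; rewrite /resterm /homog mulr_suml bop_sumE scaler_sumr.
  apply: (le_trans (ler_norm_sum _ _ _)); apply: ler_sum => -[k /=] /[!ltnS] kn _.
  rewrite bopMnE -bopME normrMn -scalerMnr lerMn2r; apply/orP; right.
  have := bnd (n - k)%N k (p + q)%N; rewrite subnK// addnA => /le_trans; apply.
  rewrite -[r ^+ (n - k) * _]exprD subnK// /GRing.scale/= mulrAC.
  by rewrite !ler_wpM2r ?exprn_ge0// ler_norm.
apply: is_cvg_seriesZ; exact: is_cvg_homog.
Qed.

Lemma cvg_res p q :
  (series (resterm x y w one p q) @ \oo --> res x y w one p q)%classic.
Proof. exact: is_cvg_res. Qed.

Lemma res00 : res x y w one 0 0 = one.
Proof.
apply: cvg_lim => //; rewrite -cvg_shiftS.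
apply: cvg_near_cst.
near=> n; rewrite /series/= big_nat_recl// big1 ?addr0 => [|i _];
  by rewrite /resterm homog00 ?mul0r// expr0 mulr1.
Unshelve. all: by end_near. Qed.

(** The recurrence of the coefficients, summed. *)
Lemma resSl p q :
  (u - x) (res x y w one p.+1 q) = res x y w one p q.
Proof.
have S := @cvg_res p.+1 q.
suff E : u (res x y w one p.+1 q) = res x y w one p q + x (res x y w one p.+1 q).
  by rewrite bopBE E addrK.
rewrite -(cvg_lim _ (bop_cvg u S))//; apply: cvg_lim => //.
rewrite -cvg_shiftS.
have S0 : ((fun n => series (resterm x y w one p q) n.+1) @ \oo -->
    res x y w one p q)%classic.
  by rewrite cvg_shiftS; exact: cvg_res.
apply: (cvg_trans _ (cvgD S0 (bop_cvg x S))); apply: near_eq_cvg.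
near=> n.
change (series (resterm x y w one p q) n.+1 +
  x (series (resterm x y w one p.+1 q) n) =
  u (series (resterm x y w one p.+1 q) n.+1)).
rewrite /= /series/= !big_nat_recl// linearD !linear_sum /= -addrA.
have uh p' q' n' m : u ((homog x y p' q' n' * w ^+ m.+1) one) =
    (homog x y p' q' n' * w ^+ m) one.
  rewrite -bopME mulrA (comm_homog _ _ _ (res_ux D) (res_uy D)) -mulrA.
  by rewrite (exprS w m) [u * (w * _)]mulrA (res_uw D) mul1r.
rewrite -big_split/= /resterm addnS addSn uh !homog_at0; congr (_ + _).
apply: eq_bigr => i _; rewrite !(addnS, addSn) uh homogSl.
by rewrite -bopME mulrA -bopDE -mulrDl.
Unshelve. all: by end_near. Qed.

(** An operator that commutes with [x], [y] and [w] is determined on all these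
    vectors by its value at [one], so identities between such operators need only
    be checked there. *)
Lemma res_comm_eq0 (E : bop X) p q :
  commute_data x y w E -> E one = 0 -> E (res x y w one p q) = 0.
Proof.
move=> [Ex Ey Ew] E1; rewrite -(cvg_lim _ (bop_cvg E (@cvg_res p q)))//.
apply: cvg_lim => //; apply: cvg_near_cst; near=> n.
rewrite linear_sum big1// => i _.
change ((E * (homog x y p q i * w ^+ (i + p + q))) one = 0).
rewrite (commrM (comm_homog _ _ _ Ex Ey) (commrX _ Ew)).
by rewrite bopME E1 linear0.
Unshelve. all: by end_near. Qed.

End Theory.

Lemma res_swap x y w one p q :
  GRing.comm x y -> res x y w one p q = res y x w one q p.
Proof.
move=> xy; rewrite /res; congr (limn (series _)); apply/funext => n.
by rewrite /resterm homogC// -addnA [(p + q)%N]addnC addnA.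
Qed.

Lemma resSr x y w u one p q : resolvent_data x y w u one ->
  (u - y) (res x y w one p q.+1) = res x y w one p q.
Proof.
move=> D; rewrite !(res_swap _ _ _ _ (res_xy D)).
exact/resSl/resolvent_data_swap.
Qed.

End ResolventSeries.

Arguments res00 {R X} x y w one.
Arguments cvg_res {R X x y w u one} D p q.

(** * The seven expansions for commuting operators *)

Section ResolventIdentities.
Context {R : realType} {X : completeNormedModType R}.
Context {x y w u Q Z : bop X} {one : X}.
Hypothesis D : resolvent_data x y w u one.
Hypotheses (Qc : commute_data x y w Q) (Zc : commute_data x y w Z).
Hypothesis Q1 : Q one = (u - x) ((u - y) one).
Hypothesis Z1 : Z one *+ 2 = (u - x) one + (u - y) one.

Local Notation F := (res x y w one).

Let ux_comm : commute_data x y w (u - x).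
Proof.
case: D => xy xw yw ux uy uw wu _.
by split; apply/commr_sym/commrB => //; apply/commr_sym => //;
  rewrite /GRing.comm uw wu.
Qed.

Let uy_comm : commute_data x y w (u - y).
Proof.
case: D => xy xw yw ux uy uw wu _.
by split; apply/commr_sym/commrB => //; apply/commr_sym => //;
  rewrite /GRing.comm uw wu.
Qed.

Lemma res_Q p q : Q (F p q) = (u - x) ((u - y) (F p q)).
Proof.
have [[ax ay aw] [bx by_ bw] [Qx Qy Qw]] := And3 ux_comm uy_comm Qc.
apply/eqP; rewrite -bopME -subr_eq0 -bopBE; apply/eqP.
apply: (res_comm_eq0 D); last by rewrite bopBE bopME Q1 subrr.
by split; apply/commr_sym/commrB; [|apply: commrM| |apply: commrM| |apply: commrM];
  exact: commr_sym.
Qed.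

Lemma res_Z p q : Z (F p q) *+ 2 = (u - x) (F p q) + (u - y) (F p q).
Proof.
have [[ax ay aw] [bx by_ bw] [Zx Zy Zw]] := And3 ux_comm uy_comm Zc.
apply/eqP; rewrite -bopMnE -bopDE -subr_eq0 -bopBE; apply/eqP.
apply: (res_comm_eq0 D); last by rewrite bopBE bopMnE bopDE Z1 subrr.
by split; apply/commr_sym/commrB; [apply: commrMn|apply: commrD|apply: commrMn
  |apply: commrD|apply: commrMn|apply: commrD]; exact: commr_sym.
Qed.

Lemma res_Q_SS p q : Q (F p.+1 q.+1) = F p q.
Proof. by rewrite res_Q (resSr _ _ D) (resSl D). Qed.

Lemma res_Z_SS p q : Z (F p.+1 q.+1) *+ 2 = F p q.+1 + F p.+1 q.
Proof. by rewrite res_Z (resSr _ _ D) (resSl D). Qed.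

Context {Qi : bop X}.
Hypothesis QiQ : Qi * Q = 1.

(** The inverse of [Q] undoes [res_Q_SS]; all values below are read off from
    this. *)
Lemma resQi p q : Qi (F p q) = F p.+1 q.+1.
Proof. by rewrite -(res_Q_SS p q) -bopME QiQ. Qed.

Lemma resQi_one : Qi one = F 1 1.
Proof. by rewrite -resQi res00. Qed.

Lemma resQi_ux : Qi ((u - x) one) = F 0 1.
Proof. by rewrite -{1}(res00 x y w one) -(resSr _ _ D) -res_Q -bopME QiQ. Qed.

Lemma resQi_uy : Qi ((u - y) one) = F 1 0.
Proof.
have [ax ay aw] := ux_comm.
have uyC : GRing.comm (u - x) (u - y).
  by apply: commrB => //; apply/commr_sym/commrB => //; exact: res_ux D.
rewrite -{1}(res00 x y w one) -(resSl D) -(bopME (u - y)) -uyC bopME -res_Q.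
by rewrite -bopME QiQ.
Qed.

Local Notation G a b n := ((x ^+ a * y ^+ b * w ^+ n) one).

Lemma restermE p q n : resterm x y w one p q n =
  \sum_(k < n.+1) (negbin p (n - k) * negbin q k)%:R *: G (n - k) k (n + p + q).
Proof.
rewrite /resterm /homog mulr_suml bop_sumE; apply: eq_bigr => k _.
by rewrite mulrnAl bopMnE scaler_nat.
Qed.

Lemma resterm_p0 p n :
  resterm x y w one p 0 n = (negbin p n)%:R *: G n 0 (n + p).
Proof.
rewrite restermE big_ord_recl big1 ?addr0 => [|k _]; last first.
  by rewrite negbin0 muln0 scale0r.
by rewrite negbin0 muln1 subn0 addn0.
Qed.

Lemma sum_nat1 n (H : nat -> X) :
  \sum_(1 <= k < n.+2) H k = \sum_(k < n.+1) H k.+1.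
Proof. by rewrite big_add1 big_mkord. Qed.

(** In the seven expansions the degree [n] of [resterm] is [m] minus the starting
    index, and the exponent of [y] is [k - 1]. *)
Lemma expansion_D : has_expansion ((- 4) *: Qi one) (- 4) 1 (fun m =>
  \sum_(1 <= k < m.+1) G (m - k) (k - 1) (1 + m)).
Proof.
rewrite resQi_one.
apply: (has_expansion_series _ _ (cvg_res D 1 1)) => n.
rewrite restermE !addn1 sum_nat1; apply: eq_bigr => k _.
by rewrite !negbin1 scale1r subn1 subSS.
Qed.

Lemma expansion_Lap : has_expansion ((- 8) *: Qi (Qi ((u - y) one))) (- 8) 2
  (fun m => \sum_(1 <= k < m) (m - k)%:R *: G (m - k - 1) (k - 1) (1 + m)).
Proof.
rewrite resQi_uy resQi; apply: (has_expansion_series _ _ (cvg_res D 2 1)) => n.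
rewrite restermE !(addn1, addn2) sum_nat1; apply: eq_bigr => k _.
have kn : (k <= n)%N by exact: ltn_ord k.
by rewrite negbin1 negbin2 muln1 !subn1 subSS subSn.
Qed.

Lemma expansion_LapD : has_expansion (16 *: Qi (Qi one)) 16 3 (fun m =>
  \sum_(1 <= k < m - 1) ((m - k - 1) * k)%:R *: G (m - k - 2) (k - 1) (1 + m)).
Proof.
rewrite resQi_one resQi.
apply: (has_expansion_series _ _ (cvg_res D 2 2)) => n.
rewrite restermE addn2 addn3 [(n.+3 - 1)%N]subn1 sum_nat1.
apply: eq_bigr => k _; have kn : (k <= n)%N by exact: ltn_ord k.
have -> : (n.+3 - k.+1 - 1 = (n - k).+1)%N by lia.
have -> : (n.+3 - k.+1 - 2 = n - k)%N by lia.
by rewrite !negbin2 subn1 succnK !addn2 add1n.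
Qed.

Lemma expansion_D2 : has_expansion ((- 8) *: Qi (Qi ((u - x) one))) (- 8) 2
  (fun m => \sum_(1 <= k < m) k%:R *: G (m - k - 1) (k - 1) (1 + m)).
Proof.
rewrite resQi_ux resQi; apply: (has_expansion_series _ _ (cvg_res D 1 2)) => n.
rewrite restermE !(addn1, addn2) sum_nat1; apply: eq_bigr => k _.
have kn : (k <= n)%N by exact: ltn_ord k.
by rewrite negbin1 negbin2 mul1n !subn1 subSS subSn.
Qed.

(** By [2 Z = (u - x) + (u - y)], the vector [4 Z F_(2,1)] is
    [2 F_(1,1) + 2 F_(2,0)]. *)
Lemma expansion_Dbar :
  has_expansion (4 *: Z (Qi (Qi ((u - y) one))) + 2 *: Qi one) 2 1 (fun m =>
    m%:R *: G (m - 1) 0 (1 + m) +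
    2 *: \sum_(1 <= k < m.+1) G (m - k) (k - 1) (1 + m)).
Proof.
have -> : 4 *: Z (Qi (Qi ((u - y) one))) + 2 *: Qi one =
    2 *: (F 2 0 + 2 *: F 1 1).
  rewrite resQi_one resQi_uy resQi.
  rewrite (_ : 4 = 2 * 2)//; last by ring.
  rewrite -scalerA [2 *: Z _]scaler_nat res_Z_SS -scalerDr.
  by congr (2 *: _); rewrite scaler_nat mulr2n addrAC addrC.
apply: (has_expansion_series _ _
  (cvg_seriesD (cvg_res D 2 0) (cvg_seriesZ 2 (cvg_res D 1 1)))) => n.
rewrite resterm_p0 restermE !addn1 subn1 negbin2 addn2; congr (_ + _ *: _).
rewrite sum_nat1; apply: eq_bigr => k _.
by rewrite !negbin1 scale1r subn1 subSS.
Qed.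

(** The splitting of [2 Z] is used twice, starting from [F_(3,2)]. *)
Lemma expansion_Dbar2 :
  has_expansion (32 *: Z (Z (Qi (Qi (Qi ((u - y) one)))))) 4 2 (fun m =>
    (m * (m - 1))%:R *: G (m - 2) 0 (1 + m) +
    2 *: \sum_(1 <= k < m) (2 * m - k)%:R *: G (m - k - 1) (k - 1) (1 + m)).
Proof.
have -> : 32 *: Z (Z (Qi (Qi (Qi ((u - y) one))))) =
    4 *: (2 *: F 3 0 + (4 *: F 2 1 + 2 *: F 1 2)).
  have ZZ : Z (Z (F 3 2)) *+ 4 = F 1 2 + F 2 1 + (F 2 1 + F 3 0).
    rewrite (mulrnA _ 2 2) -[Z _ *+ 2]linearMn res_Z_SS linearD mulrnDl.
    by rewrite !res_Z_SS.
  rewrite resQi_uy !resQi.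
  have -> : 4 *: (2 *: F 3 0 + (4 *: F 2 1 + 2 *: F 1 2)) =
      8 *: (F 1 2 + F 2 1 + (F 2 1 + F 3 0)).
    have -> : 8 = 4 * 2 :> R by ring.
    have -> : 4 *: F 2 1 = 2 *: (F 2 1 + F 2 1).
      by rewrite scalerDr -scalerDl; congr (_ *: _); ring.
    rewrite -!scalerDr scalerA [F 3 0 + _]addrC [_ + F 1 2]addrC.
    by rewrite addrA -addrA.
  by rewrite -ZZ -[Z _ *+ 4]scaler_nat scalerA; congr (_ *: _); ring.
apply: (has_expansion_series _ _ (cvg_seriesD (cvg_seriesZ 2 (cvg_res D 3 0))
  (cvg_seriesD (cvg_seriesZ 4 (cvg_res D 2 1))
     (cvg_seriesZ 2 (cvg_res D 1 2))))) => n.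
rewrite resterm_p0 !restermE addn2 subn1 subn2 addn3 scalerA -natrM.
rewrite [(2 * negbin _ _)%N]mulnC negbin3.
congr (_ + _); rewrite !scaler_sumr sum_nat1 -big_split.
apply: eq_bigr => k _; have kn : (k <= n)%N by exact: ltn_ord k.
rewrite !negbin1 !negbin2 !(addn1, addn2) mul1n muln1 !scalerA.
rewrite -[RHS]/(_ + _) -scalerDl.
rewrite -!natrM -natrD.
have -> : (n.+2 - k.+1 - 1 = n - k)%N by lia.
rewrite [(k.+1 - 1)%N]subn1 succnK; congr (_ *: _); congr (_%:R); lia.
Qed.

Lemma expansion_LapDbar :
  has_expansion ((- 64) *: Z (Qi (Qi (Qi ((u - y) one))))) (- 16) 3 (fun m =>
    \sum_(1 <= k < m - 1)
      ((m - k - 1) * (m + k))%:R *: G (m - k - 2) (k - 1) (1 + m)).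
Proof.
have -> : (- 64) *: Z (Qi (Qi (Qi ((u - y) one)))) =
    (- 16) *: (2 *: F 2 2 + 2 *: F 3 1).
  rewrite resQi_uy !resQi -scalerDr -res_Z_SS -[Z _ *+ 2]scaler_nat !scalerA.
  by congr (_ *: _); ring.
apply: (has_expansion_series _ _ (cvg_seriesD (cvg_seriesZ 2 (cvg_res D 2 2))
  (cvg_seriesZ 2 (cvg_res D 3 1)))) => n.
rewrite !restermE !scaler_sumr addn3 [(n.+3 - 1)%N]subn1 sum_nat1 -big_split.
apply: eq_bigr => k _; have kn : (k <= n)%N by exact: ltn_ord k.
rewrite !negbin1 !negbin2 !(addn3, addn2, addn1) muln1 !scalerA.
rewrite -[RHS]/(_ + _) -scalerDl.
rewrite -!natrM -natrD [(2 * negbin 3 _)%N]mulnC negbin3.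
have -> : (n.+3 - k.+1 - 2 = n - k)%N by lia.
rewrite [(k.+1 - 1)%N]subn1 succnK; congr (_ *: _); congr (_%:R).
have -> : (n.+3 - k.+1 - 1 = (n - k).+1)%N by lia.
have -> : (n.+3 + k.+1 = 2 * k.+1 + (n - k).+2)%N by lia.
by rewrite mulnDr mulnCA [((n - k).+2 * _)%N]mulnC.
Qed.

End ResolventIdentities.

(** * Left and right multiplications *)

Section MultiplicationOperators.
Context {R : realType} {V : normedModType R}.
Local Notation cbop := (cliff (bop V)).
Implicit Types a b c : cbop.

Lemma lmul_bounded a : ( *%R a : cbop -> cbop) \in @bounded_linear _ cbop.
Proof.
apply/bounded_linearP; split=> [k b c|]; first by rewrite mulrDr -cliff_scaleAr.
by exists `|a| => b; exact: cliff_normM.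
Qed.

Lemma rmul_bounded a : ( *%R^~ a : cbop -> cbop) \in @bounded_linear _ cbop.
Proof.
apply/bounded_linearP; split=> [k b c|]; first by rewrite /= mulrDl -cliff_scaleAl.
by exists `|a| => b; rewrite mulrC; exact: cliff_normM.
Qed.

Definition lmul a : bop cbop := Bop (lmul_bounded a).
Definition rmul a : bop cbop := Bop (rmul_bounded a).

Lemma lmulE a b : lmul a b = a * b. Proof. by []. Qed.
Lemma rmulE a b : rmul a b = b * a. Proof. by []. Qed.

Lemma rmulB_lmulE (a b c : cbop) : (rmul a - lmul b) c = c * a - b * c.
Proof. by []. Qed.

Lemma lmulB_rmulE (a b c : cbop) : (lmul a - rmul b) c = a * c - c * b.
Proof. by []. Qed.

Lemma lmulM a b : lmul (a * b) = lmul a * lmul b.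
Proof. by apply: bop_ext => c; exact/esym/mulrA. Qed.
Lemma rmulM a b : rmul (a * b) = rmul b * rmul a.
Proof. by apply: bop_ext => c; exact: mulrA. Qed.
Lemma lmul1 : lmul 1 = 1.
Proof. by apply: bop_ext => c; exact: mul1r. Qed.
Lemma rmul1 : rmul 1 = 1.
Proof. by apply: bop_ext => c; exact: mulr1. Qed.
Lemma lmulX a n : lmul (a ^+ n) = lmul a ^+ n.
Proof. by elim: n => [|n IH]; rewrite ?lmul1// !exprS lmulM IH. Qed.
Lemma rmulX a n : rmul (a ^+ n) = rmul a ^+ n.
Proof. by elim: n => [|n IH]; rewrite ?rmul1// exprS exprSr rmulM IH. Qed.

(** Associativity. This is what makes the noncommuting elements [T] and [s^-1]
    act by commuting operators, from opposite sides. *)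
Lemma lmul_rmul a b : GRing.comm (lmul a) (rmul b).
Proof. by apply: bop_ext => c; exact: mulrA. Qed.
Lemma lmul_comm a b : GRing.comm a b -> GRing.comm (lmul a) (lmul b).
Proof. by move=> ab; rewrite /GRing.comm -!lmulM ab. Qed.
Lemma rmul_comm a b : GRing.comm a b -> GRing.comm (rmul a) (rmul b).
Proof. by move=> ab; rewrite /GRing.comm -!rmulM ab. Qed.

Lemma norm_exprM a b n : `|a ^+ n * b| <= `|a| ^+ n * `|b|.
Proof.
elim: n => [|n IH]; first by rewrite !expr0 !mul1r.
rewrite !exprS -!mulrA (le_trans (cliff_normM _ _))//.
by rewrite ler_wpM2l.
Qed.

Lemma norm_Mexpr a b n : `|b * a ^+ n| <= `|b| * `|a| ^+ n.
Proof.
elim: n => [|n IH]; first by rewrite !expr0 !mulr1.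
rewrite !exprSr !mulrA (le_trans (cliff_normM _ _))//.
by rewrite ler_wpM2r.
Qed.

End MultiplicationOperators.

(* Unfolding these two definitions lets unification compare Clifford products
   componentwise. *)
#[local] Opaque lmul rmul.

Lemma inverse_unique (A : pzRingType) (a b c : A) :
  b * a = 1 -> a * c = 1 -> inverse a = b /\ inverse a = c.
Proof.
move=> ba ac; have bc : b = c by rewrite -[b]mulr1 -ac mulrA ba mul1r.
suff -> : inverse a = b by split.
have [ai ia] : a * inverse a = 1 /\ inverse a * a = 1.
  apply: (@xgetI _ 0 [set y | a * y = 1 /\ y * a = 1]%classic b).
  by split=> //; rewrite bc.
by rewrite -[LHS]mul1r -ba -mulrA ai mulr1.
Qed.

Lemma comm_inv (A : pzRingType) (a b c : A) :
  a * b = 1 -> b * a = 1 -> GRing.comm c a -> GRing.comm c b.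
Proof.
move=> ab ba ca; rewrite /GRing.comm -[LHS]mul1r -ba -mulrA [a * (c * b)]mulrA.
by rewrite -ca -!mulrA ab mulr1.
Qed.

Lemma has_expansion_eq (R : realType) (W : normedModType R) (v v' : W) (c : R)
    m (f f' : nat -> W) :
  has_expansion v c m f -> v' = v -> f' =1 f -> has_expansion v' c m f'.
Proof. by move=> + -> /funext ->. Qed.

Section Factorizations.
Context {A : pzRingType}.
Implicit Types S T Tb U : A.

Lemma quadratic_factor_left S T Tb : GRing.comm S (T + Tb) ->
  S ^+ 2 - S * (T + Tb) + T * Tb = (S - Tb) * S - T * (S - Tb).
Proof.
move=> SD; rewrite SD mulrBl mulrBr mulrDl opprB opprD expr2 -!addrA.
by congr (_ + _); rewrite addrC -addrA.
Qed.

Lemma quadratic_factor_right S T Tb : GRing.comm T Tb ->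
  S ^+ 2 - S * (T + Tb) + T * Tb = S * (S - Tb) - (S - Tb) * T.
Proof.
move=> TTb; rewrite mulrBr mulrBl mulrDr TTb opprB opprD expr2 -!addrA.
by congr (_ + _); rewrite addrC -addrA.
Qed.

Lemma double_subr S T Tb U : U *+ 2 = T + Tb ->
  (S - U) *+ 2 = (S - T) + (S - Tb).
Proof. by move=> UD; rewrite mulrnBl UD mulr2n addrACA opprD. Qed.

Lemma quadratic_comm S T Tb : GRing.comm S (T + Tb) -> GRing.comm S (T * Tb) ->
  GRing.comm S (S ^+ 2 - S * (T + Tb) + T * Tb).
Proof.
move=> SD SM; apply: commrD => //; apply: commrB; first exact: commrX.
exact: commrM.
Qed.

Lemma mulr_sqr_right S T : S * T * T = S * T ^+ 2.
Proof. by rewrite -mulrA -expr2. Qed.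

Lemma mulr_cube_right S T : S * T * T * T = S * T ^+ 3.
Proof. by rewrite mulr_sqr_right -mulrA -exprS. Qed.

Lemma mulr_sqr_left S T : T * (T * S) = T ^+ 2 * S.
Proof. by rewrite mulrA -expr2. Qed.

Lemma mulr_cube_left S T : T * (T * (T * S)) = T ^+ 3 * S.
Proof. by rewrite mulr_sqr_left mulrA -exprSr. Qed.

End Factorizations.

(** The data shared by the left and the right expansions: [Tb], [Si], [Q], [Z]
    stand for the conjugate of [T], the inverse of [s], the operator
    [Q_{c,s}(T)] and [s - T_0]. Neither [T] nor [Tb] has to commute with [S]. *)
Record kernel_data (R : realType) (V : completeNormedModType R)
    (T Tb S Si Q Z : cliff (bop V)) : Prop := KernelData {
  kd_TTb : GRing.comm T Tb;
  kd_SSi : S * Si = 1;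
  kd_SiS : Si * S = 1;
  kd_QSi : GRing.comm Q Si;
  kd_ZSi : GRing.comm Z Si;
  kd_Q_left : Q = (S - Tb) * S - T * (S - Tb);
  kd_Q_right : Q = S * (S - Tb) - (S - Tb) * T;
  kd_Z2 : Z *+ 2 = (S - T) + (S - Tb);
  kd_Tb_le : `|Tb| <= `|T|;
  kd_Si_le : exists K sigma : R, [/\ 0 <= sigma, `|T| * sigma < 1 &
    forall n, `|Si ^+ n| <= K * sigma ^+ n] }.

Section CliffordResolvent.
Context {R : realType} {V : completeNormedModType R}.
Local Notation cbop := (cliff (bop V)).
Context {T Tb S Si Q Z : cbop}.
Hypothesis E : kernel_data T Tb S Si Q Z.

Lemma kernel_bound : exists K r sigma : R, [/\ 0 <= r < 1, 0 <= sigma &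
  forall a b n, `|T| ^+ a * (`|Tb| ^+ b * `|Si ^+ (a + b + n)|) <=
    K * r ^+ (a + b) * sigma ^+ n].
Proof.
have [K [sigma [s0 Ts Si_le]]] := kd_Si_le E.
exists K, (`|T| * sigma), sigma; split=> // [|a b n]; first by rewrite mulr_ge0.
apply: (@le_trans _ _ (`|T| ^+ a * (`|T| ^+ b * (K * sigma ^+ (a + b + n))))).
  rewrite ler_wpM2l ?exprn_ge0// ler_pM ?exprn_ge0//.
  by rewrite lerXn2r ?nnegrE ?(kd_Tb_le E).
by rewrite exprMn !exprD le_eqVlt; apply/orP; left; apply/eqP; ring.
Qed.

Lemma lterm a b n : (lmul T ^+ a * lmul Tb ^+ b * rmul Si ^+ n) 1 =
  T ^+ a * Tb ^+ b * Si ^+ n.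
Proof. by rewrite -!lmulX -rmulX -lmulM bopME lmulE rmulE mul1r. Qed.

Lemma rterm a b n : (rmul T ^+ a * rmul Tb ^+ b * lmul Si ^+ n) 1 =
  Si ^+ n * T ^+ a * Tb ^+ b.
Proof.
rewrite -!rmulX -lmulX -rmulM bopME rmulE lmulE mulr1 -mulrA; congr (_ * _).
exact/commrX/commr_sym/commrX/(kd_TTb E).
Qed.

(** For the left expansions [T] acts from the left and [s] from the right; the
    vector to which the operators are applied is the unit of the ring. *)
Lemma left_resolvent_data :
  resolvent_data (lmul T) (lmul Tb) (rmul Si) (rmul S) 1.
Proof.
split.
- exact/lmul_comm/(kd_TTb E).
- exact: lmul_rmul.
- exact: lmul_rmul.
- exact/commr_sym/lmul_rmul.
- exact/commr_sym/lmul_rmul.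
- by rewrite -rmulM (kd_SiS E) rmul1.
- by rewrite -rmulM (kd_SSi E) rmul1.
have [K [r [sigma [r01 s0 bound]]]] := kernel_bound.
exists K, r, sigma; split=> // a b n; rewrite lterm -mulrA.
apply: le_trans (bound a b n).
apply: (le_trans (norm_exprM _ _ _)); rewrite ler_wpM2l ?exprn_ge0//.
exact: norm_exprM.
Qed.

Lemma right_resolvent_data :
  resolvent_data (rmul T) (rmul Tb) (lmul Si) (lmul S) 1.
Proof.
split.
- exact/rmul_comm/(kd_TTb E).
- exact/commr_sym/lmul_rmul.
- exact/commr_sym/lmul_rmul.
- exact: lmul_rmul.
- exact: lmul_rmul.
- by rewrite -lmulM (kd_SSi E) lmul1.
- by rewrite -lmulM (kd_SiS E) lmul1.
have [K [r [sigma [r01 s0 bound]]]] := kernel_bound.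
exists K, r, sigma; split=> // a b n; rewrite rterm.
apply: le_trans (bound a b n).
apply: (le_trans (norm_Mexpr _ _ _)).
apply: (@le_trans _ _ (`|Si ^+ (a + b + n)| * `|T| ^+ a * `|Tb| ^+ b)).
  by rewrite ler_wpM2r ?exprn_ge0// norm_Mexpr.
by rewrite le_eqVlt; apply/orP; left; apply/eqP; ring.
Qed.

Lemma left_Q1 : rmul Q 1 = (rmul S - lmul T) ((rmul S - lmul Tb) 1).
Proof.
rewrite rmulE mul1r !rmulB_lmulE mul1r mulr1.
exact: kd_Q_left E.
Qed.

Lemma right_Q1 : lmul Q 1 = (lmul S - rmul T) ((lmul S - rmul Tb) 1).
Proof.
rewrite lmulE mulr1 !lmulB_rmulE mul1r mulr1.
exact: kd_Q_right E.
Qed.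

Lemma left_Z1 : rmul Z 1 *+ 2 = (rmul S - lmul T) 1 + (rmul S - lmul Tb) 1.
Proof.
rewrite rmulE !rmulB_lmulE !mul1r !mulr1.
exact: kd_Z2 E.
Qed.

Lemma right_Z1 : lmul Z 1 *+ 2 = (lmul S - rmul T) 1 + (lmul S - rmul Tb) 1.
Proof.
rewrite lmulE !lmulB_rmulE !mul1r !mulr1.
exact: kd_Z2 E.
Qed.

Lemma rmulQ_comm : commute_data (lmul T) (lmul Tb) (rmul Si) (rmul Q).
Proof.
split; [exact/commr_sym/lmul_rmul|exact/commr_sym/lmul_rmul|].
exact/rmul_comm/(kd_QSi E).
Qed.

Lemma lmulQ_comm : commute_data (rmul T) (rmul Tb) (lmul Si) (lmul Q).
Proof.
split; [exact/lmul_rmul|exact/lmul_rmul|].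
exact/lmul_comm/(kd_QSi E).
Qed.

(** The left series is a left inverse of [Q] and the right series is a right
    inverse, so they agree and [Q] is invertible. *)
Lemma inverse_Q : Q * inverse Q = 1 /\ inverse Q * Q = 1.
Proof.
have HL := res_Q_SS left_resolvent_data rmulQ_comm left_Q1 0 0.
have HR := res_Q_SS right_resolvent_data lmulQ_comm right_Q1 0 0.
rewrite !res00 rmulE lmulE in HL HR.
have [iL iR] := inverse_unique HL HR.
by split; [rewrite iR|rewrite iL].
Qed.

(* An abstract inverse keeps unification from unfolding [inverse Q] in the ring
   identities below. *)
Context {I : cbop}.
Hypotheses (QI : Q * I = 1) (IQ : I * Q = 1).

Let LQ : rmul I * rmul Q = 1.
Proof. by rewrite -rmulM QI rmul1. Qed.
Let RQ : lmul I * lmul Q = 1.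
Proof. by rewrite -lmulM IQ lmul1. Qed.

Lemma rmulZ_comm : commute_data (lmul T) (lmul Tb) (rmul Si) (rmul Z).
Proof.
split; [exact/commr_sym/lmul_rmul|exact/commr_sym/lmul_rmul|].
exact/rmul_comm/(kd_ZSi E).
Qed.

Lemma lmulZ_comm : commute_data (rmul T) (rmul Tb) (lmul Si) (lmul Z).
Proof.
split; [exact/lmul_rmul|exact/lmul_rmul|].
exact/lmul_comm/(kd_ZSi E).
Qed.

Lemma left_expansion_D : has_expansion
  ((- 4) *: I) (- 4) 1 (fun m =>
   \sum_(1 <= k < m.+1) T ^+ (m - k) * Tb ^+ (k - 1) * Si ^+ (1 + m)).
Proof.
apply: (has_expansion_eq
  (expansion_D left_resolvent_data rmulQ_comm left_Q1 LQ)).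
  by rewrite rmulE mul1r.
by move=> m; apply: eq_bigr => k _; rewrite lterm.
Qed.

Lemma right_expansion_D : has_expansion
  ((- 4) *: I) (- 4) 1 (fun m =>
   \sum_(1 <= k < m.+1) Si ^+ (1 + m) * T ^+ (m - k) * Tb ^+ (k - 1)).
Proof.
apply: (has_expansion_eq
  (expansion_D right_resolvent_data lmulQ_comm right_Q1 RQ)).
  by rewrite lmulE mulr1.
by move=> m; apply: eq_bigr => k _; rewrite rterm.
Qed.

Lemma left_expansion_Lap : has_expansion
  ((- 8) *: ((S - Tb) * I ^+ 2)) (- 8) 2 (fun m =>
   \sum_(1 <= k < m) (m - k)%:R *:
     (T ^+ (m - k - 1) * Tb ^+ (k - 1) * Si ^+ (1 + m))).
Proof.
apply: (has_expansion_eq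
  (expansion_Lap left_resolvent_data rmulQ_comm left_Q1 LQ)).
  by rewrite rmulB_lmulE !rmulE mul1r mulr1 (mulr_sqr_right _ I).
by move=> m; apply: eq_bigr => k _; rewrite lterm.
Qed.

Lemma right_expansion_Lap : has_expansion
  ((- 8) *: (I ^+ 2 * (S - Tb))) (- 8) 2 (fun m =>
   \sum_(1 <= k < m) (m - k)%:R *:
     (Si ^+ (1 + m) * T ^+ (m - k - 1) * Tb ^+ (k - 1))).
Proof.
apply: (has_expansion_eq
  (expansion_Lap right_resolvent_data lmulQ_comm right_Q1 RQ)).
  by rewrite lmulB_rmulE !lmulE mul1r mulr1 (mulr_sqr_left _ I).
by move=> m; apply: eq_bigr => k _; rewrite rterm.
Qed.

Lemma left_expansion_LapD : has_expansion
  (16 *: I ^+ 2) 16 3 (fun m =>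
   \sum_(1 <= k < m - 1) ((m - k - 1) * k)%:R *:
     (T ^+ (m - k - 2) * Tb ^+ (k - 1) * Si ^+ (1 + m))).
Proof.
apply: (has_expansion_eq
  (expansion_LapD left_resolvent_data rmulQ_comm left_Q1 LQ)).
  by rewrite !rmulE mul1r -expr2.
by move=> m; apply: eq_bigr => k _; rewrite lterm.
Qed.

Lemma right_expansion_LapD : has_expansion
  (16 *: I ^+ 2) 16 3 (fun m =>
   \sum_(1 <= k < m - 1) ((m - k - 1) * k)%:R *:
     (Si ^+ (1 + m) * T ^+ (m - k - 2) * Tb ^+ (k - 1))).
Proof.
apply: (has_expansion_eq
  (expansion_LapD right_resolvent_data lmulQ_comm right_Q1 RQ)).
  by rewrite !lmulE mulr1 -expr2.
by move=> m; apply: eq_bigr => k _; rewrite rterm.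
Qed.

Lemma left_expansion_D2 : has_expansion
  ((- 8) *: ((S - T) * I ^+ 2)) (- 8) 2 (fun m =>
   \sum_(1 <= k < m) k%:R *:
     (T ^+ (m - k - 1) * Tb ^+ (k - 1) * Si ^+ (1 + m))).
Proof.
apply: (has_expansion_eq
  (expansion_D2 left_resolvent_data rmulQ_comm left_Q1 LQ)).
  by rewrite rmulB_lmulE !rmulE mul1r mulr1 (mulr_sqr_right _ I).
by move=> m; apply: eq_bigr => k _; rewrite lterm.
Qed.

Lemma right_expansion_D2 : has_expansion
  ((- 8) *: (I ^+ 2 * (S - T))) (- 8) 2 (fun m =>
   \sum_(1 <= k < m) k%:R *:
     (Si ^+ (1 + m) * T ^+ (m - k - 1) * Tb ^+ (k - 1))).
Proof.
apply: (has_expansion_eq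
  (expansion_D2 right_resolvent_data lmulQ_comm right_Q1 RQ)).
  by rewrite lmulB_rmulE !lmulE mul1r mulr1 (mulr_sqr_left _ I).
by move=> m; apply: eq_bigr => k _; rewrite rterm.
Qed.

Lemma left_expansion_Dbar : has_expansion
  (4 *: ((S - Tb) * I ^+ 2 * Z) + 2 *: I) 2 1 (fun m =>
   (m%:R *: T ^+ (m - 1) +
     2 *: \sum_(1 <= k < m.+1) T ^+ (m - k) * Tb ^+ (k - 1)) *
   Si ^+ (1 + m)).
Proof.
apply: (has_expansion_eq
  (expansion_Dbar left_resolvent_data rmulQ_comm rmulZ_comm
    left_Q1 left_Z1 LQ)).
  by rewrite rmulB_lmulE !rmulE !mul1r mulr1 (mulr_sqr_right _ I).
move=> m; rewrite mulrDl -!cliff_scaleAl mulr_suml lterm expr0 mulr1.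
by congr (_ + _ *: _); apply: eq_bigr => k _; rewrite lterm ?cliff_scaleAl.
Qed.

Lemma right_expansion_Dbar : has_expansion
  (4 *: (Z * I ^+ 2 * (S - Tb)) + 2 *: I) 2 1 (fun m =>
   Si ^+ (1 + m) *
   (m%:R *: T ^+ (m - 1) +
     2 *: \sum_(1 <= k < m.+1) T ^+ (m - k) * Tb ^+ (k - 1))).
Proof.
apply: (has_expansion_eq
  (expansion_Dbar right_resolvent_data lmulQ_comm lmulZ_comm
    right_Q1 right_Z1 RQ)).
  by rewrite lmulB_rmulE !lmulE mul1r !mulr1 (mulr_sqr_left _ I) -[in LHS]mulrA.
move=> m; rewrite mulrDr -!cliff_scaleAr mulr_sumr rterm expr0 mulr1.
congr (_ + _ *: _); apply: eq_bigr => k _.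
by rewrite rterm -?cliff_scaleAr mulrA.
Qed.

Lemma left_expansion_Dbar2 : has_expansion
  (32 *: ((S - Tb) * I ^+ 3 * Z ^+ 2)) 4 2 (fun m =>
   ((m * (m - 1))%:R *: T ^+ (m - 2) +
     2 *: \sum_(1 <= k < m) (2 * m - k)%:R *: (T ^+ (m - k - 1) * Tb ^+ (k - 1))) *
   Si ^+ (1 + m)).
Proof.
apply: (has_expansion_eq
  (expansion_Dbar2 left_resolvent_data rmulQ_comm rmulZ_comm
    left_Q1 left_Z1 LQ)).
  rewrite rmulB_lmulE !rmulE mul1r mulr1; congr (_ *: _).
  by rewrite -(mulr_sqr_right (_ * I ^+ 3)) -(mulr_cube_right (S - Tb)).
move=> m; rewrite mulrDl -!cliff_scaleAl mulr_suml lterm expr0 mulr1.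
by congr (_ + _ *: _); apply: eq_bigr => k _; rewrite lterm ?cliff_scaleAl.
Qed.

Lemma right_expansion_Dbar2 : has_expansion
  (32 *: (Z ^+ 2 * I ^+ 3 * (S - Tb))) 4 2 (fun m =>
   Si ^+ (1 + m) *
   ((m * (m - 1))%:R *: T ^+ (m - 2) +
     2 *: \sum_(1 <= k < m) (2 * m - k)%:R *: (T ^+ (m - k - 1) * Tb ^+ (k - 1)))).
Proof.
apply: (has_expansion_eq
  (expansion_Dbar2 right_resolvent_data lmulQ_comm lmulZ_comm
    right_Q1 right_Z1 RQ)).
  rewrite lmulB_rmulE !lmulE mul1r mulr1 (mulr_cube_left _ I).
  by rewrite (mulr_sqr_left _ Z) -[in LHS]mulrA.
move=> m; rewrite mulrDr -!cliff_scaleAr mulr_sumr rterm expr0 mulr1.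
congr (_ + _ *: _); apply: eq_bigr => k _.
by rewrite rterm -?cliff_scaleAr mulrA.
Qed.

Lemma left_expansion_LapDbar : has_expansion
  ((- 64) *: ((S - Tb) * I ^+ 3 * Z)) (- 16) 3 (fun m =>
   \sum_(1 <= k < m - 1) ((m - k - 1) * (m + k))%:R *:
     (T ^+ (m - k - 2) * Tb ^+ (k - 1) * Si ^+ (1 + m))).
Proof.
apply: (has_expansion_eq
  (expansion_LapDbar left_resolvent_data rmulQ_comm rmulZ_comm
    left_Q1 left_Z1 LQ)).
  rewrite rmulB_lmulE !rmulE mul1r mulr1; congr (_ *: _).
  by rewrite -(mulr_cube_right (S - Tb)).
by move=> m; apply: eq_bigr => k _; rewrite lterm.
Qed.

Lemma right_expansion_LapDbar : has_expansion
  ((- 64) *: (Z * I ^+ 3 * (S - Tb))) (- 16) 3 (fun m =>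
   \sum_(1 <= k < m - 1) ((m - k - 1) * (m + k))%:R *:
     (Si ^+ (1 + m) * T ^+ (m - k - 2) * Tb ^+ (k - 1))).
Proof.
apply: (has_expansion_eq
  (expansion_LapDbar right_resolvent_data lmulQ_comm lmulZ_comm
    right_Q1 right_Z1 RQ)).
  by rewrite lmulB_rmulE !lmulE mul1r mulr1 (mulr_cube_left _ I) -[in LHS]mulrA.
by move=> m; apply: eq_bigr => k _; rewrite rterm.
Qed.

End CliffordResolvent.

(** * The expansions of the resolvent operators *)

Theorem proposition9p2 (R : realType) (V : completeNormedModType R)
    (T : cliff (bop V)) (s : 'rV[R]_6) :
  BC01 T -> `|T| < euclidean_norm s ->
  rhoS T s /\
  (S_D_L s T = S_D_R s T /\
   has_expansion (S_D_L s T) (- 4) 1 (fun m =>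
     \sum_(1 <= k < m.+1)
       T ^+ (m - k) * clconj T ^+ (k - 1) * paraop_negpow s (1 + m)) /\
   has_expansion (S_D_R s T) (- 4) 1 (fun m =>
     \sum_(1 <= k < m.+1)
       paraop_negpow s (1 + m) * T ^+ (m - k) * clconj T ^+ (k - 1))) /\
  (has_expansion (S_Lap_L s T) (- 8) 2 (fun m =>
     \sum_(1 <= k < m) (m - k)%:R *:
       (T ^+ (m - k - 1) * clconj T ^+ (k - 1) * paraop_negpow s (1 + m))) /\
   has_expansion (S_Lap_R s T) (- 8) 2 (fun m =>
     \sum_(1 <= k < m) (m - k)%:R *:
       (paraop_negpow s (1 + m) * T ^+ (m - k - 1) * clconj T ^+ (k - 1)))) /\
  (S_LapD_L s T = S_LapD_R s T /\
   has_expansion (S_LapD_L s T) 16 3 (fun m =>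
     \sum_(1 <= k < m - 1) ((m - k - 1) * k)%:R *:
       (T ^+ (m - k - 2) * clconj T ^+ (k - 1) * paraop_negpow s (1 + m))) /\
   has_expansion (S_LapD_R s T) 16 3 (fun m =>
     \sum_(1 <= k < m - 1) ((m - k - 1) * k)%:R *:
       (paraop_negpow s (1 + m) * T ^+ (m - k - 2) * clconj T ^+ (k - 1)))) /\
  (has_expansion (S_D2_L s T) (- 8) 2 (fun m =>
     \sum_(1 <= k < m) k%:R *:
       (T ^+ (m - k - 1) * clconj T ^+ (k - 1) * paraop_negpow s (1 + m))) /\
   has_expansion (S_D2_R s T) (- 8) 2 (fun m =>
     \sum_(1 <= k < m) k%:R *:
       (paraop_negpow s (1 + m) * T ^+ (m - k - 1) * clconj T ^+ (k - 1)))) /\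
  (has_expansion (S_Dbar_L s T) 2 1 (fun m =>
     (m%:R *: T ^+ (m - 1) +
      2 *: \sum_(1 <= k < m.+1) T ^+ (m - k) * clconj T ^+ (k - 1)) *
     paraop_negpow s (1 + m)) /\
   has_expansion (S_Dbar_R s T) 2 1 (fun m =>
     paraop_negpow s (1 + m) *
     (m%:R *: T ^+ (m - 1) +
      2 *: \sum_(1 <= k < m.+1) T ^+ (m - k) * clconj T ^+ (k - 1)))) /\
  (has_expansion (S_Dbar2_L s T) 4 2 (fun m =>
     ((m * (m - 1))%:R *: T ^+ (m - 2) +
      2 *: \sum_(1 <= k < m) (2 * m - k)%:R *:
             (T ^+ (m - k - 1) * clconj T ^+ (k - 1))) *
     paraop_negpow s (1 + m)) /\
   has_expansion (S_Dbar2_R s T) 4 2 (fun m =>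
     paraop_negpow s (1 + m) *
     ((m * (m - 1))%:R *: T ^+ (m - 2) +
      2 *: \sum_(1 <= k < m) (2 * m - k)%:R *:
             (T ^+ (m - k - 1) * clconj T ^+ (k - 1))))) /\
  (has_expansion (S_LapDbar_L s T) (- 16) 3 (fun m =>
     \sum_(1 <= k < m - 1) ((m - k - 1) * (m + k))%:R *:
       (T ^+ (m - k - 2) * clconj T ^+ (k - 1) * paraop_negpow s (1 + m))) /\
   has_expansion (S_LapDbar_R s T) (- 16) 3 (fun m =>
     \sum_(1 <= k < m - 1) ((m - k - 1) * (m + k))%:R *:
       (paraop_negpow s (1 + m) * T ^+ (m - k - 2) * clconj T ^+ (k - 1)))).
Proof.
move=> [t [tC TE]] Ts; pose Tb := clconj T.
pose z := s ord0; pose S : cliff (bop V) := paraop s.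
pose Si : cliff (bop V) := cliff_op (inverse (paravec z)).
have s_gt0 : 0 < euclidean_norm s by exact: le_lt_trans Ts.
have z0 : sqnorm z != 0 by move: s_gt0; rewrite sqrtr_gt0 => /gt_eqF ->.
have [zi iz] := paravec_inv z0; have [invE _] := inverse_unique iz zi.
have SSi : S * Si = 1 by rewrite -cliff_opM invE zi cliff_op1.
have SiS : Si * S = 1 by rewrite -cliff_opM invE iz cliff_op1.
have negpowE n : paraop_negpow s n = Si ^+ n by exact: cliff_opX.
have Si_le n : `|Si ^+ n| <= 6 * (euclidean_norm s)^-1 ^+ n.
  rewrite -cliff_opX (le_trans (cliff_op_norm _))// invE.
  apply: (le_trans (sum_coord_paravec_pow _ _)).
  by rewrite (sqnorm_parainv z0) sqrtrV// sumr_ge0// => i _; exact: sqr_ge0.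
have sigma_ge0 : 0 <= (euclidean_norm s)^-1 by rewrite invr_ge0 ltW.
have Tsigma : `|T| * (euclidean_norm s)^-1 < 1 by rewrite ltr_pdivrMr// mul1r.
have Tb_le : `|Tb| <= `|T| by rewrite /Tb TE norm_clconj.
(* The conjugate of [T] is arranged so that [T T'] and [T + T'] have no Clifford
   part; real Clifford numbers commute with such operators. *)
have TTbE : T * Tb = clscalar (\sum_i t i ^+ 2).
  by rewrite /Tb TE clconj_paravec paravec_mulconj.
have TTb : GRing.comm T Tb.
  by rewrite /GRing.comm TTbE /Tb TE clconj_paravec paravec_conjmul.
have TDb : T + Tb = clscalar (t ord0 *+ 2).
  by rewrite /Tb TE clconj_paravec paravec_addconj.
have SD : GRing.comm S (T + Tb).
  by rewrite TDb; exact/commr_sym/cliff_op_comm.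
have SM : GRing.comm S (T * Tb).
  by rewrite TTbE; exact/commr_sym/cliff_op_comm.
have ST0 : GRing.comm S (component0 T).
  by rewrite TE component0_paravec; exact/commr_sym/cliff_op_comm.
have T0D : component0 T *+ 2 = T + Tb.
  by rewrite TDb TE component0_paravec !mulr2n -clbladeD.
pose Z := S - component0 T.
have Z2 : Z *+ 2 = (S - T) + (S - Tb) by exact: double_subr.
have Q_left : Qcs s T = (S - Tb) * S - T * (S - Tb).
  exact: quadratic_factor_left.
have Q_right : Qcs s T = S * (S - Tb) - (S - Tb) * T.
  exact: quadratic_factor_right.
have QSi : GRing.comm (Qcs s T) Si.
  by apply: (comm_inv SSi SiS); apply/commr_sym; exact: quadratic_comm.
have ZSi : GRing.comm Z Si.
  by apply: (comm_inv SSi SiS); apply/commr_sym/commrB; first exact: commr_refl.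
have E : kernel_data T Tb S Si (Qcs s T) Z.
  by split=> //; exists 6, (euclidean_norm s)^-1.
have [QI IQ] := inverse_Q E.
have -> : paraop_negpow s = (fun n => Si ^+ n) :> (nat -> cliff (bop V)).
  exact/funext.
split; first by exists (inverse (Qcs s T)).
split; first split; first by [].
  by split; [exact: (left_expansion_D E QI)|exact: (right_expansion_D E IQ)].
split.
  by split; [exact: (left_expansion_Lap E QI)|exact: (right_expansion_Lap E IQ)].
split; first split; first by [].
  by split; [exact: (left_expansion_LapD E QI)|exact: (right_expansion_LapD E IQ)].
split.
  by split; [exact: (left_expansion_D2 E QI)|exact: (right_expansion_D2 E IQ)].
split.
  by split; [exact: (left_expansion_Dbar E QI)|exact: (right_expansion_Dbar E IQ)].
split.
  by split; [exact: (left_expansion_Dbar2 E QI)|exact: (right_expansion_Dbar2 E IQ)].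
split; first exact: (left_expansion_LapDbar E QI).
exact: (right_expansion_LapDbar E IQ).
Qed.
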